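(* Consider an infinite horizon discounted Markov decision process $(\mathcal S,\mathcal A,\mathbb P,\sigma,\theta,\boldsymbol\rho_0)$ with $\mathcal S=\{s_1,\dots,s_{|\mathcal S|}\}$ and the problem $\min_{\boldsymbol\pi\in\mathcal X}J^{\boldsymbol\pi}(\boldsymbol\rho_0)$, $\mathcal X=\prod_{i=1}^{|\mathcal S|}\Delta_{\mathcal A}$, where $J^{\boldsymbol\pi}(\boldsymbol\rho_0)=\mathbb E_{s_0\sim\boldsymbol\rho_0}[V^{\boldsymbol\pi}(s_0)]$. Let $\boldsymbol\pi^*=\{\boldsymbol\pi^*(\cdot|s)\in\Delta_{\mathcal A}\}_{s\in\mathcal S}$ be the global optimal solution of this problem. Then $\boldsymbol\pi\mapsto J^{\boldsymbol\pi}(\boldsymbol\rho_0)$ satisfies the generalized quasar-convexity (GQC) condition with respect to $\boldsymbol\pi^*$, with internal function $\boldsymbol F_i(\boldsymbol\pi)=\boldsymbol Q^{\boldsymbol\pi}(s_i,\cdot)$ for the variable block $\boldsymbol\pi_i=\boldsymbol\pi(\cdot|s_i)$: there are positive scalars $\gamma_1,\dots,\gamma_{|\mathcal S|}$ with $$J^{\boldsymbol\pi^*}(\boldsymbol\rho_0)\ge J^{\boldsymbol\pi}(\boldsymbol\rho_0)+\sum_{i=1}^{|\mathcal S|}\frac1{\gamma_i}\langle\boldsymbol Q^{\boldsymbol\pi}(s_i,\cdot),\boldsymbol\pi^*(\cdot|s_i)-\boldsymbol\pi(\cdot|s_i)\rangle\quad\text{for all }\boldsymbol\pi\in\mathcal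 X.$$ Moreover, with $\theta$ the discount factor, $\Theta_1=\theta$, $\Theta_2=1$ and $K_0=1$, there is a fixed $\boldsymbol y\in\mathbb R^{|\mathcal S||\mathcal A|}$ such that $\|\boldsymbol R^{\boldsymbol F}_{K,\boldsymbol y}(\boldsymbol\pi)\|_\infty\le\Theta_1\theta^K$ for every integer $K>K_0$ and $\boldsymbol\pi\in\mathcal X$, and $\|\boldsymbol P^{\boldsymbol F}_{K,\boldsymbol y}(\boldsymbol\pi)\|_\infty\le\Theta_2$ for every positive integer $K$ and $\boldsymbol\pi\in\mathcal X$.
   Context: MDP: $\mathcal S$ and $\mathcal A$ are finite; $\mathbb P(s|s',a')$ is the probability of moving from $s'$ to $s$ under action $a'$; $\sigma:\mathcal S\times\mathcal A\to[0,1]$ is a cost; $\theta\in[0,1)$ is the discount factor; $\boldsymbol\rho_0$ is an (arbitrary) initial distribution on $\mathcal S$. $\Delta_{\mathcal A}$ is the probability simplex over $\mathcal A$. A policy is $\boldsymbol\pi:\mathcal S\to\Delta_{\mathcal A}$; with $a_t\sim\boldsymbol\pi(\cdot|s_t)$ and $s_{t+1}\sim\mathbb P(\cdot|s_t,a_t)$, $$V^{\boldsymbol\pi}(s)=(1-\theta)\mathbb E\Big[\sum_{t\ge0}\theta^t\sigma(s_t,a_t)\,\Big|\,\boldsymbol\pi,s_0=s\Big],\quad Q^{\boldsymbol\pi}(s,a)=(1-\theta)\mathbb E\Big[\sum_{t\ge0}\theta^t\sigma(s_t,a_t)\,\Big|\,\boldsymbol\pi,s_0=s,a_0=a\Big],$$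 and $\boldsymbol Q^{\boldsymbol\pi}(s_i,\cdot)=(Q^{\boldsymbol\pi}(s_i,a))_{a\in\mathcal A}$. GQC: a function $f$ on a product of $d$ simplexes $\mathcal X$ is generalized quasar-convex with respect to a minimizer $\boldsymbol x^*$ if there are vector-valued functions $\boldsymbol F_i$ on $\mathcal X$ (with values in the space of the $i$-th block) and positive scalars $\gamma_i$, $i=1,\dots,d$, such that $f(\boldsymbol x^* )\ge f(\boldsymbol x)+\sum_{i=1}^d\frac1{\gamma_i}\langle\boldsymbol F_i(\boldsymbol x),\boldsymbol x_i^*-\boldsymbol x_i\rangle$ for all $\boldsymbol x\in\mathcal X$; $\boldsymbol F_i$ is called the internal function of $f$ for block $\boldsymbol x_i$. As functions of $\boldsymbol\pi$, the $Q^{\boldsymbol\pi}(s,a)$ are rational and are extended to $\boldsymbol\pi\in\mathbb R^{|\mathcal S||\mathcal A|}$ (where defined) by the Bellman equations $Q^{\boldsymbol\pi}(s,a)=(1-\theta)\sigma(s,a)+\theta\sum_{s',a'}\mathbb P(s'|s,a)\boldsymbol\pi(a'|s')Q^{\boldsymbol\pi}(s',a')$; derivatives are taken of this extension. For a smooth scalar function $\phi$, $R^{\phi}_{K,\boldsymbol y}(\boldsymbol x)=\phi(\boldsymbol x)-\sum_{i=0}^K\sum_{|\boldsymbol\alpha|=i}\frac{D^{\boldsymbol\alpha}\phi(\boldsymbol y)}{\boldsymbol\alpha!}(\boldsymbol x-\boldsymbol y)^{\boldsymbol\alpha}$ and $P^{\phi}_{K,\boldsymbol y}(\boldsymbol x)=\sum_{i=0}^K\sum_{|\boldsymbol\alpha|=i}\frac{|D^{\boldsymbol\alpha}\phi(\boldsymbol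 y)|}{\boldsymbol\alpha!}(|\boldsymbol x|+|\boldsymbol y|)^{\boldsymbol\alpha}$ (multi-index notation, coordinatewise absolute values); $\boldsymbol R^{\boldsymbol F}_{K,\boldsymbol y}$ and $\boldsymbol P^{\boldsymbol F}_{K,\boldsymbol y}$ collect these for the scalar components of $\boldsymbol F=(\boldsymbol F_1^\top,\dots,\boldsymbol F_{|\mathcal S|}^\top)^\top$.
   Formalization: The global optimal solution is taken to minimise J for every initial distribution, not only for the given one; for a minimiser of the single problem that is suboptimal at states it never visits, the GQC inequality with positive scalars fails. *)

(* Defs.v *)
From HB Require Import structures.
From mathcomp Require Import all_boot all_order all_algebra.
From mathcomp Require Import all_classical all_reals all_analysis.
From mathcomp Require Import lra.

Set Implicit Arguments.
Unset Strict Implicit.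
Unset Printing Implicit Defensive.

Import Order.TTheory GRing.Theory Num.Theory.
Import numFieldNormedType.Exports.

Local Open Scope classical_set_scope.
Local Open Scope ring_scope.

Definition distr (R : realType) (T : finType) (p : T -> R) : Prop :=
  (forall x, 0 <= p x) /\ \sum_x p x = 1.

(* A point of a product of p simplexes is a p x q matrix, its i-th block being
   its i-th row; 'M[R]_(p, q) is the ambient space. *)
Definition prod_simplex (R : realType) p q : set 'M[R]_(p, q) :=
  [set x | forall i, distr (x i)].
Arguments prod_simplex : clear implicits.

(* The set of states is 'I_n.+1 and the set of actions 'I_m.+1 (both are
   nonempty as soon as an initial distribution and a policy exist).
   [trans M s a s'] is the probability of moving from s to s' under a. *)
Record mdp (R : realType) (n m : nat) := Mdp {
  trans : 'I_n.+1 -> 'I_m.+1 -> 'I_n.+1 -> R;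
  trans_distr : forall s a, distr (trans s a);
  cost : 'I_n.+1 -> 'I_m.+1 -> R;
  cost01 : forall s a, 0 <= cost s a <= 1;
  discount : R;
  discount01 : 0 <= discount < 1;
  init : 'I_n.+1 -> R;
  init_distr : distr init }.

HB.instance Definition _ n := isPointed.Build 'I_n.+1 ord0.

Definition coordinate_sets (T : Type) : set (set (nat -> T)) :=
  [set C | exists t x, C = [set w | w t = x]].

(* Sequences (s_t, a_t)_{t >= 0} with the product sigma-algebra. *)
Notation trajectory n m :=
  (g_sigma_algebraType (@coordinate_sets ('I_n.+1 * 'I_m.+1)%type)).

(* Existence of finite-state Markov chains, realized on [0, 1[ under the
   Lebesgue measure by nested interval partitions. *)
Section finite_chain.
Context (R : realType) (T : finType).
Implicit Types (f : T -> R) (lo len u : R).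

Let cum f (y : T) : R := \sum_(z | (enum_rank z < enum_rank y)%N) f z.

Let in_block f lo len u y :=
  (lo + len * cum f y <= u) && (u < lo + len * (cum f y + f y)).

Let cum_le f y y' : (forall x, 0 <= f x) ->
  (enum_rank y < enum_rank y')%N -> cum f y + f y <= cum f y'.
Proof.
move=> f0 yy'; rewrite /cum addrC.
have -> : f y + \sum_(z | (enum_rank z < enum_rank y)%N) f z =
    \sum_(z | (enum_rank z <= enum_rank y)%N) f z.
  rewrite [RHS](bigD1 y)//=; congr (_ + _); apply: eq_bigl => z.
  by rewrite ltn_neqAle andbC (inj_eq val_inj) (inj_eq enum_rank_inj).
rewrite big_mkcond [leRHS]big_mkcond; apply: ler_sum => z _.
case: ifPn => [zy|_]; last by case: ifP.
by rewrite (leq_ltn_trans zy yy').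
Qed.

Let cum_ge0 f y : distr f -> 0 <= cum f y.
Proof. by move=> [f0 _]; apply: sumr_ge0. Qed.

Let cum_le1 f y : distr f -> cum f y + f y <= 1.
Proof.
move=> [f0 <-]; rewrite [leRHS](bigD1 y)//= [leLHS]addrC lerD2l /cum.
rewrite big_mkcond [leRHS]big_mkcond; apply: ler_sum => z _.
case: ifPn => [zl|_]; last by case: ifP.
by case: eqP zl => [->|//]; rewrite ltnn.
Qed.

Let in_block_uniq f lo len u y y' : (forall x, 0 <= f x) -> 0 <= len ->
  in_block f lo len u y -> in_block f lo len u y' -> y = y'.
Proof.
move=> f0 l0 /andP[a1 a2] /andP[b1 b2].
apply: enum_rank_inj; apply: val_inj; apply/eqP.
case: ltngtP => // h; exfalso.
- have := ler_wpM2l l0 (cum_le f0 h); lra.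
- have := ler_wpM2l l0 (cum_le f0 h); lra.
Qed.

Let in_block_ex f lo len u : distr f -> 0 <= len -> lo <= u < lo + len ->
  exists y, in_block f lo len u y.
Proof.
move=> [f0 f1] l0 /andP[lou ulo].
pose q k := [exists y, (enum_rank y == k :> nat) && (u < lo + len * (cum f y + f y))].
have T0 : (0 < #|T|)%N.
  rewrite lt0n; apply/eqP => T0; move: f1; rewrite big_pred0.
    by move/eqP; rewrite eq_sym oner_eq0.
  by move=> x; have := fintype0 x T0.
have ltT : (#|T|.-1 < #|T|)%N by rewrite prednK.
pose ymax : T := enum_val (Ordinal ltT).
have exq : exists k, q k.
  exists #|T|.-1; apply/existsP; exists ymax; rewrite enum_valK eqxx /=.
  suff -> : cum f ymax + f ymax = 1 by rewrite mulr1.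
  rewrite -f1 (bigD1 ymax)//= addrC; congr (_ + _); apply: eq_bigl => z.
  rewrite enum_valK /= -(inj_eq enum_rank_inj) -(inj_eq val_inj) enum_valK /=.
  by rewrite ltn_neqAle -ltnS prednK// ltn_ord andbT.
case: (ex_minnP exq) => k /existsP[y /andP[/eqP yk uy]] kmin.
exists y; rewrite /in_block uy andbT.
case: k => [|k] in yk kmin *.
  rewrite /cum big_pred0 ?mulr0 ?addr0// => z; rewrite yk ltn0 //.
have kT : (k < #|T|)%N by rewrite ltnW// -yk ltn_ord.
pose y' : T := enum_val (Ordinal kT).
have /negP qk : ~~ q k by apply/negP => /kmin; rewrite ltnn.
rewrite leNgt; apply/negP => h; apply: qk; apply/existsP; exists y'.
rewrite enum_valK eqxx /=; suff -> : cum f y' + f y' = cum f y by [].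
rewrite [RHS](bigD1 y') /= ?enum_valK ?yk//= addrC; congr (_ + _).
apply: eq_bigl => z.
rewrite enum_valK /= -(inj_eq enum_rank_inj) -(inj_eq val_inj) enum_valK /=.
by rewrite ltnS ltn_neqAle andbC.
Qed.

Variables (x0 : T) (nu : T -> R) (p : T -> T -> R).
Hypotheses (dnu : distr nu) (dp : forall x, distr (p x)).

Let refine f lo len u : T * (R * R) :=
  let y := odflt x0 [pick y | in_block f lo len u y] in
  (y, (lo + len * cum f y, len * f y)).

Let st u t : T * (R * R) :=
  iteri t (fun _ s => refine (p s.1) s.2.1 s.2.2 u) (refine nu 0 1 u).

Let blk (x : nat -> T) (t : nat) : R * R :=
  iteri t (fun k s => (s.1 + s.2 * cum (p (x k)) (x k.+1),
                       s.2 * p (x k) (x k.+1)))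
    (0 + 1 * cum nu (x 0%N), 1 * nu (x 0%N)).

Let blk2 x t : (blk x t).2 = nu (x 0%N) * \prod_(k < t) p (x k) (x k.+1).
Proof.
elim: t => [|t IH] /=; first by rewrite big_ord0 mul1r mulr1.
by rewrite IH big_ord_recr /= mulrA.
Qed.

Let blk2_ge0 x t : 0 <= (blk x t).2.
Proof.
rewrite blk2 mulr_ge0 ?dnu.1// prodr_ge0// => k _; exact: (dp _).1.
Qed.

Let refineP f lo len u y : distr f -> 0 <= len -> lo <= u < lo + len ->
  (refine f lo len u).1 = y <-> in_block f lo len u y.
Proof.
move=> df l0 lu; rewrite /refine /=; case: pickP => [z zb|nz] /=.
  split=> [<-//|yb]; exact: (in_block_uniq df.1 l0 zb yb).
have [z zb] := in_block_ex df l0 lu.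
by have := nz z; rewrite zb.
Qed.

Let st_blk u x t : 0 <= u < 1 ->
  (forall k, (k <= t)%N -> (st u k).1 = x k) <->
  (blk x t).1 <= u < (blk x t).1 + (blk x t).2.
Proof.
move=> u01.
suff : ((forall k, (k <= t)%N -> (st u k).1 = x k) <->
  (blk x t).1 <= u < (blk x t).1 + (blk x t).2) /\
  ((forall k, (k <= t)%N -> (st u k).1 = x k) -> (st u t).2 = blk x t) by case.
elim: t => [|t [IH1 IH2]].
  split.
    have h := @refineP nu 0 1 u (x 0%N) dnu ler01.
    rewrite add0r u01 in h; have {}h := h erefl.
    split=> [/(_ 0%N erefl) /h|].
      by rewrite /in_block /= mulrDr addrA.
    rewrite /= -addrA -mulrDr => /h e k; rewrite leqn0 => /eqP -> //.
  by move=> /(_ 0%N erefl) /= <-.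
have spl : (forall k, (k <= t.+1)%N -> (st u k).1 = x k) <->
    (forall k, (k <= t)%N -> (st u k).1 = x k) /\ (st u t.+1).1 = x t.+1.
  split=> [h|[h1 h2] k]; first by split=> [k kt|]; apply: h => //; exact: leqW.
  by rewrite leq_eqVlt => /orP[/eqP ->//|]; rewrite ltnS => /h1.
have stS : (forall k, (k <= t)%N -> (st u k).1 = x k) ->
    st u t.+1 = refine (p (x t)) (blk x t).1 (blk x t).2 u.
  by move=> h; rewrite -(IH2 h) -(h t (leqnn t)).
have subb : (blk x t.+1).1 <= u < (blk x t.+1).1 + (blk x t.+1).2 ->
    (blk x t).1 <= u < (blk x t).1 + (blk x t).2.
  rewrite /= => /andP[a b].
  have c0 := cum_ge0 (x t.+1) (dp (x t)); have c1 := cum_le1 (x t.+1) (dp (x t)).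
  have l0 := blk2_ge0 x t.
  have := mulr_ge0 l0 c0; have := ler_wpM2l l0 c1; lra.
split.
  split.
    move=> /spl[h1 h2]; have b := IH1.1 h1; rewrite (stS h1) in h2.
    move/(refineP _ (dp _) (blk2_ge0 x t) b) : h2.
    by rewrite /in_block mulrDr addrA.
  move=> b; have b' := subb b; have h1 := IH1.2 b'; apply/spl; split => //.
  rewrite (stS h1); apply/(refineP _ (dp _) (blk2_ge0 x t) b').
  by move: b; rewrite /in_block mulrDr addrA.
move=> /spl[h1 h2]; rewrite (stS h1); rewrite (stS h1) in h2.
by rewrite /= -h2.
Qed.

Let X u t : T := if 0 <= u < 1 then (st u t).1 else x0.

Let X_blk x t : [set u | forall k, (k <= t)%N -> X u k = x k] `&` `[0, 1[ =
  `[(blk x t).1, (blk x t).1 + (blk x t).2[ `&` `[0, 1[.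
Proof.
apply/seteqP; split=> u /= [h]; rewrite !in_itv /= => u01; split => //.
- rewrite ?in_itv/=; apply/st_blk => // k kt.
  by rewrite -(h k kt) /X u01.
- move: h; rewrite in_itv /= => /(st_blk x t u01).2 h k kt.
  by rewrite /X u01 h.
Qed.

Let measurableX t x : measurable [set u | X u t = x].
Proof.
have -> : [set u | X u t = x] =
  (~` `[0, 1[ `&` [set u : R | x0 = x]) `|`
  \bigcup_(g in [set g : {ffun 'I_t.+1 -> T} | g ord_max = x])
    ([set u | forall k, (k <= t)%N -> X u k = g (inord k)] `&` `[0, 1[).
  apply/seteqP; split=> u /=.
    case: (boolP (0 <= u < 1)) => u01 Xu.
      right; exists [ffun k : 'I_t.+1 => X u k] => /=; first by rewrite ffunE.
      split=> [k kt|]; last by rewrite in_itv.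
      by rewrite ffunE inordK.
    left; split; first by rewrite in_itv /=; exact/negP.
    by move: Xu; rewrite /X (negbTE u01).
  move=> [[/negP]|[g /= gx [h _]]].
    by rewrite in_itv /= => u01 <-; rewrite /X (negbTE u01).
  rewrite h// -gx; congr (g _); apply: val_inj => /=; exact: inordK.
apply: measurableU.
  apply: measurableI; first by apply: measurableC.
  case: (pselect (x0 = x)) => e.
    by rewrite (_ : [set u | _] = setT)//; apply/seteqP; split.
  by rewrite (_ : [set u | _] = set0)//; apply/seteqP; split.
apply: fin_bigcup_measurable => [|g _]; first exact: finite_finset.
by rewrite (X_blk (fun k => g (inord k)) t); exact: measurableI.
Qed.

Let blk_in x t u : (blk x t).1 <= u < (blk x t).1 + (blk x t).2 -> 0 <= u < 1.
Proof.
elim: t u => [|t IH] u /=.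
  move=> /andP[].
  have := cum_ge0 (x 0%N) dnu; have := cum_le1 (x 0%N) dnu; lra.
move=> /andP[a b]; apply: IH.
have c0 := cum_ge0 (x t.+1) (dp (x t)); have c1 := cum_le1 (x t.+1) (dp (x t)).
have l0 := blk2_ge0 x t.
have := mulr_ge0 l0 c0; have := ler_wpM2l l0 c1; lra.
Qed.

Lemma finite_chain_ex : exists X : R -> nat -> T,
  (forall t x, measurable [set u | X u t = x]) /\
  forall t (x : nat -> T),
    lebesgue_measure ([set u | forall k, (k <= t)%N -> X u k = x k] `&` `[0, 1[)
    = (nu (x 0%N) * \prod_(k < t) p (x k) (x k.+1))%:E.
Proof.
exists X; split; first exact: measurableX.
move=> t x; rewrite X_blk setIidl; last first.
  by move=> u /=; rewrite !in_itv /=; exact: blk_in.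
rewrite lebesgue_measure_itv /= lte_fin ltrDl -EFinD addrAC subrr add0r -blk2.
by case: ltP => // h; congr (_%:E); apply/eqP; rewrite eq_le blk2_ge0 h.
Qed.

End finite_chain.

Section mdp_values.
Context {R : realType} {n m : nat}.
Implicit Types (M : mdp R n m) (pi : 'M[R]_(n.+1, m.+1)).
Local Notation SA := ('I_n.+1 * 'I_m.+1)%type.

Definition step M pi (x x' : SA) : R := trans M x.1 x.2 x'.1 * pi x'.1 x'.2.

(* P is the law of (s_t, a_t)_t when (s_0, a_0) has law nu,
   s_{t+1} ~ trans (s_t, a_t) and a_{t+1} ~ pi(. | s_{t+1}). *)
Definition is_law M pi (nu : SA -> R) (P : probability (trajectory n m) R) :=
  forall (t : nat) (x : nat -> SA),
    P [set w : trajectory n m | forall k, (k <= t)%N -> w k = x k] =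
    (nu (x 0%N) * \prod_(k < t) step M pi (x k) (x k.+1))%:E.

Lemma is_law_ex M pi nu : prod_simplex R n.+1 m.+1 pi -> distr nu ->
  exists P, is_law M pi nu P.
Proof.
move=> dpi dnu.
have dstep x : distr (step M pi x).
  split=> [x'|].
    by rewrite /step mulr_ge0// ?(dpi _).1// (trans_distr M _ _).1.
  rewrite -(pair_bigA _ (fun s a => trans M x.1 x.2 s * pi s a)) /=.
  under eq_bigr do rewrite -mulr_sumr (dpi _).2 mulr1.
  exact: (trans_distr M _ _).2.
have [X [mX lX]] := finite_chain_ex (point : SA) dnu dstep.
pose Y : measurableTypeR R -> trajectory n m := X.
have mY : measurable_fun setT Y.
  refine (@measurability _ _ _ (trajectory n m) setT Y (@coordinate_sets SA)
    erefl _).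
  move=> _ [_ [t [x ->]] <-]; rewrite setTI; exact: mX.
have m01 : measurable (`[0, 1[%classic : set R) by [].
pose mu0 : {measure set (measurableTypeR R) -> \bar R} :=
  mrestr (@lebesgue_measure R) m01.
pose mu :
  {measure set (trajectory n m) -> \bar R} := pushforward mu0 Y.
have muT : mu mY setT = 1%E.
  rewrite /mu /= /pushforward preimage_setT /mu0 /= /mrestr setTI.
  by rewrite lebesgue_measure_itv /= lte_fin ltr01 sube0.
exists (mnormalize (mu mY) (dirac point)) => t x.
rewrite /= /mnormalize muT /= onee_eq0 /= invr1 mule1 -lX.
by [].
Qed.

(* The law is unique, as cylinders generate the sigma-algebra; see [lawP]. *)
Definition law M pi nu : probability (trajectory n m) R :=
  get [set P | is_law M pi nu P].

Lemma lawP M pi nu : prod_simplex R n.+1 m.+1 pi -> distr nu ->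
  is_law M pi nu (law M pi nu).
Proof. by move=> dpi dnu; exact: (getPex (is_law_ex M dpi dnu)). Qed.

Definition expected_cost M pi nu : R :=
  (1 - discount M) *
  fine (\int[law M pi nu]_w
          \sum_(0 <= t <oo) (discount M ^+ t * cost M (w t).1 (w t).2)%:E)%E.

Definition value M pi (s : 'I_n.+1) : R :=
  expected_cost M pi (fun x => (x.1 == s)%:R * pi x.1 x.2).

Definition Qvalue M pi : 'M[R]_(n.+1, m.+1) :=
  \matrix_(s, a) expected_cost M pi (fun x => (x == (s, a))%:R).

Definition J M (rho : 'I_n.+1 -> R) pi : R := \sum_s rho s * value M pi s.

(* The global optimal solution of the MDP: optimal whatever the initial
   distribution. Optimality for the single distribution [init M] is too weak
   for quasar-convexity: it leaves pi arbitrary at the states that are not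
   visited from [init M], where its block may then be strictly suboptimal
   (take two absorbing states and [init M] concentrated on one of them). *)
Definition global_optimal M pi : Prop :=
  prod_simplex R n.+1 m.+1 pi /\
  forall rho, distr rho -> forall pi', prod_simplex R n.+1 m.+1 pi' ->
    J M rho pi <= J M rho pi'.

Definition bellman M pi (q : 'M[R]_(n.+1, m.+1)) : Prop :=
  forall s a, q s a = (1 - discount M) * cost M s a +
    discount M * \sum_s' \sum_a' trans M s a s' * pi s' a' * q s' a'.

(* The set of all pi (not only policies) at which the Bellman equations
   determine Q; it is open and Qext below is a rational function on it. *)
Definition bellman_defined M : set 'M[R]_(n.+1, m.+1) :=
  [set pi | exists! q, bellman M pi q].

(* Extension of Qvalue from policies to 'M[R]_(n.+1, m.+1); its values outside
   [bellman_defined M] are meaningless. *)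
Definition Qext M pi : 'M[R]_(n.+1, m.+1) :=
  if pselect (prod_simplex R n.+1 m.+1 pi) then Qvalue M pi
  else xget 0 [set q | bellman M pi q].

End mdp_values.

(* Generalized quasar-convexity of f at the minimizer xs, the internal function
   for the i-th block being the i-th row of F. *)
Definition generalized_quasar_convex (R : realType) p q
    (f : 'M[R]_(p, q) -> R) (F : 'M[R]_(p, q) -> 'M[R]_(p, q))
    (xs : 'M[R]_(p, q)) : Prop :=
  [/\ prod_simplex R p q xs,
      forall x, prod_simplex R p q x -> f xs <= f x &
      exists gamma : 'I_p -> R, (forall i, 0 < gamma i) /\
        forall x, prod_simplex R p q x ->
          f xs >= f x + \sum_i (gamma i)^-1 *
                          \sum_j F x i j * (xs i j - x i j)].

Section taylor.
Context {R : realType} {p q : nat}.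
Implicit Types (phi : 'M[R]_(p, q) -> R) (x y : 'M[R]_(p, q)).
Implicit Types (alpha : 'I_p * 'I_q -> nat).

Definition partial (ij : 'I_p * 'I_q) phi : 'M[R]_(p, q) -> R :=
  'D_(delta_mx ij.1 ij.2) phi.

(* D^alpha; the order in which the partial derivatives are taken is immaterial
   as it is only used for smooth phi. *)
Definition mderive alpha phi : 'M[R]_(p, q) -> R :=
  foldr (fun ij psi => iter (alpha ij) (partial ij) psi) phi
        (enum {: 'I_p * 'I_q}).

Definition mfact alpha : nat := \prod_ij (alpha ij)`!.

Definition mpow x alpha : R := \prod_ij x ij.1 ij.2 ^+ alpha ij.

Definition absmx x : 'M[R]_(p, q) := map_mx (fun r => `|r|) x.

(* The multi-indices of degree i are the alpha : {ffun _ -> 'I_i.+1} whose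
   entries sum to i. *)
Definition taylor_rem K phi y x : R :=
  phi x - \sum_(i < K.+1)
    \sum_(alpha : {ffun 'I_p * 'I_q -> 'I_i.+1} | (\sum_ij alpha ij == i)%N)
      mderive (fun ij => alpha ij) phi y / (mfact (fun ij => alpha ij))%:R * mpow (x - y) (fun ij => alpha ij).

Definition taylor_abs K phi y x : R :=
  \sum_(i < K.+1)
    \sum_(alpha : {ffun 'I_p * 'I_q -> 'I_i.+1} | (\sum_ij alpha ij == i)%N)
      `|mderive (fun ij => alpha ij) phi y| / (mfact (fun ij => alpha ij))%:R *
      mpow (absmx x + absmx y) (fun ij => alpha ij).

(* Componentwise versions; `| . | on the resulting matrices is the maximum of
   the absolute values of the entries. *)
Definition taylor_rem_mx K (F : 'M[R]_(p, q) -> 'M[R]_(p, q)) y x :=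
  \matrix_(i, j) taylor_rem K (fun z => F z i j) y x.

Definition taylor_abs_mx K (F : 'M[R]_(p, q) -> 'M[R]_(p, q)) y x :=
  \matrix_(i, j) taylor_abs K (fun z => F z i j) y x.

End taylor.

(* Main.v *)
Require Import Defs.
From HB Require Import structures.
From mathcomp Require Import all_boot all_order all_algebra.
From mathcomp Require Import all_classical all_reals all_analysis.
From mathcomp Require Import measurable_realfun ring lra.

(** Write P(pi) for the operator that averages a function over the next
    state-action pair under pi ([backup]), c for the cost and theta for the
    discount, so that Q = (1 - theta) c + theta P(pi) Q are the Bellman equations.

    Quasar-convexity. The performance difference lemma reads
    v_pistar - v_pi = G a, where G is the resolvent (1 - theta P)^-1 of the chain
    on states under pistar and a_i = <Q_pi(s_i, .), pistar_i - pi_i>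
    ([performance_difference]). Integrating against the initial distribution rho
    gives J(pistar) - J(pi) = sum_i (rho G)_i a_i, so (rho G)_i is the natural
    choice of 1 / gamma_i; but it is zero at the states that pistar never visits
    from rho. Taking instead (rho + u) G, with u the counting measure on
    states, adds sum_s (v_pistar(s) - v_pi(s)) <= 0 to the right-hand side,
    because pistar is optimal from every state, and makes all weights positive,
    because G dominates the identity matrix ([invmx_resolvent_ge]).

    Taylor bounds. The center is y = 0. Unfolding the Bellman equations K + 1
    times gives
      Q = (1 - theta) sum_(t <= K) theta^t P(pi)^t c + theta^(K+1) P(pi)^(K+1) Q
    ([bellman_expansion]). Since P(pi) is linear in pi, the sum is a polynomial of
    degree at most K with nonnegative coefficients, and the last term vanishes at
    0 to order K + 1, as Q is a smooth function near 0 ([smooth_bellman_sol]).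
    The sum is therefore the Taylor polynomial of Q at 0, and also equals the
    Taylor polynomial with absolute values at a policy. As Q takes values in
    [0, 1] at policies, the remainder is between 0 and theta^(K+1) and the sum is
    between 0 and 1.

    That the action values defined by expectations over trajectories solve the
    Bellman equations is [Qvalue_bellman]; it rests on the Markov property
    [integral_cylinder]. *)

Set Implicit Arguments.
Unset Strict Implicit.
Unset Printing Implicit Defensive.

Import Order.TTheory GRing.Theory Num.Theory.
Import numFieldNormedType.Exports.

Local Open Scope classical_set_scope.
Local Open Scope ring_scope.

(** * Germs of smooth functions at the zero matrix *)

Section smooth_near_zero.
Context {R : realType} {p q : nat}.
Local Notation V := 'M[R]_(p.+1, q.+1).
Local Notation I := ('I_p.+1 * 'I_q.+1)%type.
Implicit Types (f g : V -> R) (x : V) (c : I) (k : nat) (l : seq I).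

Definition partials_exist f x := forall c, derivable f x (delta_mx c.1 c.2).

(** Smoothness of germs at 0 is stated by iterated [partial]s only, the order in
    which [mderive] consumes them, so that closure under the ring operations and
    inversion is a plain induction on the order. Derivability along
    the coordinates at all points near 0 is what the product and quotient rules for
    a [partial] ask for. *)
Fixpoint smooth_upto k f : Prop :=
  if k is k'.+1 then
    (\forall x \near (0 : V), partials_exist f x) /\
    forall c, smooth_upto k' (partial c f)
  else True.

Definition smooth_at0 f := forall k, smooth_upto k f.

Lemma near0W (P : V -> Prop) : (forall x, P x) -> \forall x \near (0 : V), P x.
Proof. exact: (@nearW _ (nbhs (0 : V))). Qed.

(** Agreement near 0 is agreement near every point near 0, hence it survives
    differentiation. This is what lets [Qext] be replaced by an explicit formula
    that holds only near 0. *)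
Lemma partial_near f g c : (\forall x \near (0 : V), f x = g x) ->
  \forall x \near (0 : V), partial c f x = partial c g x.
Proof.
move=> /near_join; apply: filterS => x fg; rewrite /partial.
exact: near_eq_derive.
Qed.

Lemma smooth_upto_near k f g : (\forall x \near (0 : V), f x = g x) ->
  smooth_upto k f -> smooth_upto k g.
Proof.
elim: k f g => [//|k IH] f g fg [df sf]; split; last first.
  by move=> c; exact: (IH _ _ (partial_near c fg) (sf c)).
move/near_join : fg => fg; near=> x => c.
apply: (@near_eq_derivable _ _ _ f); first by near: x.
by apply: (near df x).
Unshelve. all: by end_near. Qed.

Lemma smooth_near f g : (\forall x \near (0 : V), f x = g x) ->
  smooth_at0 f -> smooth_at0 g.
Proof. by move=> fg sf k; exact: (smooth_upto_near fg). Qed.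

Lemma smooth_uptoW k f : smooth_upto k.+1 f -> smooth_upto k f.
Proof. by elim: k f => [//|k IH] f [df sf]; split=> // c; exact: IH. Qed.

Lemma smooth_partial f c : smooth_at0 f -> smooth_at0 (partial c f).
Proof. by move=> sf k; have [_] := sf k.+1; exact. Qed.

Lemma smooth_derivable f : smooth_at0 f -> \forall x \near (0 : V), partials_exist f x.
Proof. by move=> /(_ 1%N) []. Qed.

Lemma partial_cst a c x : partial c (fun=> a : R) x = 0.
Proof. exact: derive_cst. Qed.

Lemma smooth_cst (a : R) : smooth_at0 (fun=> a).
Proof.
move=> k; elim: k a => [//|k IH] a; split.
  by apply: near0W => x c; exact: derivable_cst.
move=> c; apply: (smooth_upto_near _ (IH 0)).
by apply: near0W => x; rewrite partial_cst.
Qed.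

Lemma is_derive_coord c (v x : V) : is_derive x v (fun z : V => z c.1 c.2) (v c.1 c.2).
Proof.
have h : (fun h : R => h^-1 *: ((h *: v + x) c.1 c.2 - x c.1 c.2)) @ 0^' -->
    v c.1 c.2.
  apply: (@cvg_trans _ ((fun=> v c.1 c.2) @ (0 : R)^')); last exact: cvg_cst.
  apply: near_eq_cvg; near=> h.
  have h0 : h != 0 by near: h; exact: nbhs_dnbhs_neq.
  by rewrite !mxE addrK /GRing.scale /= mulKf.
apply: DeriveDef; first by apply/cvg_ex; exists (v c.1 c.2).
exact: cvg_lim h.
Unshelve. all: by end_near. Qed.

Lemma partial_coord c d x :
  partial c (fun z : V => z d.1 d.2) x = (c == d)%:R.
Proof.
rewrite /partial (@derive_val _ _ _ _ _ _ _ (is_derive_coord d _ x)) mxE.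
by rewrite -pair_eqE /= ![_ == c.1]eq_sym ![_ == c.2]eq_sym.
Qed.

Lemma smooth_coord d : smooth_at0 (fun z : V => z d.1 d.2).
Proof.
case=> [//|k]; split.
  by apply: near0W => x c; have [] := is_derive_coord d (delta_mx c.1 c.2) x.
move=> c; apply: (smooth_upto_near _ (@smooth_cst (c == d)%:R k)).
by apply: near0W => x; rewrite partial_coord.
Qed.

Lemma partialD f g c x : partials_exist f x -> partials_exist g x ->
  partial c (fun z => f z + g z) x = partial c f x + partial c g x.
Proof. by move=> df dg; rewrite /partial deriveD. Qed.

Lemma smooth_uptoD k f g : smooth_upto k f -> smooth_upto k g ->
  smooth_upto k (fun z => f z + g z).
Proof.
elim: k f g => [//|k IH] f g [df sf] [dg sg]; split.
  by apply: filterS2 df dg => x df dg c; exact: derivableD.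
move=> c; apply: (smooth_upto_near _ (IH _ _ (sf c) (sg c))).
by apply: filterS2 df dg => x df dg; rewrite partialD.
Qed.

Lemma smoothD f g : smooth_at0 f -> smooth_at0 g -> smooth_at0 (fun z => f z + g z).
Proof. by move=> sf sg k; exact: smooth_uptoD. Qed.

Lemma partialM f g c x : partials_exist f x -> partials_exist g x ->
  partial c (fun z => f z * g z) x = f x * partial c g x + g x * partial c f x.
Proof. by move=> df dg; rewrite /partial deriveM. Qed.

Lemma smooth_uptoM k f g : smooth_upto k f -> smooth_upto k g ->
  smooth_upto k (fun z => f z * g z).
Proof.
elim: k f g => [//|k IH] f g sf' sg'.
have [df sf] := sf'; have [dg sg] := sg'; split.
  by apply: filterS2 df dg => x df dg c; exact: derivableM.
move=> c; apply: (smooth_upto_near _ (smooth_uptoD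
  (IH _ _ (smooth_uptoW sf') (sg c)) (IH _ _ (smooth_uptoW sg') (sf c)))).
by apply: filterS2 df dg => x df dg; rewrite partialM.
Qed.

Lemma smoothM f g : smooth_at0 f -> smooth_at0 g -> smooth_at0 (fun z => f z * g z).
Proof. by move=> sf sg k; exact: smooth_uptoM. Qed.

Lemma smoothZ (a : R) f : smooth_at0 f -> smooth_at0 (fun z => a * f z).
Proof. by apply: smoothM; exact: smooth_cst. Qed.

(** One order at a time: the derivative of 1/f is the product of - (1/f)^2, which
    is smooth up to the previous order by induction, and of a derivative of f. *)
Lemma smoothV f : (\forall x \near (0 : V), f x != 0) -> smooth_at0 f ->
  smooth_at0 (fun z => (f z)^-1).
Proof.
move=> f0 sf; elim=> [//|k IH]; have df := smooth_derivable sf; split.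
  by apply: filterS2 f0 df => x fx dfx c; exact: derivableV.
move=> c.
have s1 := smooth_uptoM (@smooth_cst (-1) k)
  (smooth_uptoM (smooth_uptoM IH IH) (smooth_partial c sf k)).
apply: (smooth_upto_near _ s1).
apply: filterS2 f0 df => x fx dfx; rewrite /partial deriveV//.
by rewrite /GRing.scale /= mulN1r mulNr -expr2 exprVn.
Qed.

Lemma smooth_sum (T : Type) (r : seq T) (P : pred T) (F : T -> V -> R) :
  (forall i, P i -> smooth_at0 (F i)) -> smooth_at0 (fun z => \sum_(i <- r | P i) F i z).
Proof.
move=> sF; elim: r => [|i r IH].
  rewrite (_ : (fun=> _) = fun=> 0); first exact: smooth_cst.
  by apply/funext => z; rewrite big_nil.
case: (boolP (P i)) => Pi; last first.
  rewrite (_ : (fun=> _) = fun z => \sum_(i <- r | P i) F i z) //.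
  by apply/funext => z; rewrite big_cons (negbTE Pi).
rewrite (_ : (fun=> _) = fun z => F i z + \sum_(i <- r | P i) F i z); last first.
  by apply/funext => z; rewrite big_cons Pi.
by apply: smoothD => //; exact: sF.
Qed.

Lemma smooth_prod (T : Type) (r : seq T) (P : pred T) (F : T -> V -> R) :
  (forall i, P i -> smooth_at0 (F i)) -> smooth_at0 (fun z => \prod_(i <- r | P i) F i z).
Proof.
move=> sF; elim: r => [|i r IH].
  rewrite (_ : (fun=> _) = fun=> 1); first exact: smooth_cst.
  by apply/funext => z; rewrite big_nil.
case: (boolP (P i)) => Pi; last first.
  rewrite (_ : (fun=> _) = fun z => \prod_(i <- r | P i) F i z) //.
  by apply/funext => z; rewrite big_cons (negbTE Pi).
rewrite (_ : (fun=> _) = fun z => F i z * \prod_(i <- r | P i) F i z); last first.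
  by apply/funext => z; rewrite big_cons Pi.
by apply: smoothM => //; exact: sF.
Qed.

(** With [smooth_adj] and [smoothV], this makes the entries of an inverse matrix
    smooth by Cramer's rule. *)
Lemma smooth_det k (A : V -> 'M[R]_k) :
  (forall i j, smooth_at0 (fun z => A z i j)) -> smooth_at0 (fun z => \det (A z)).
Proof.
move=> sA; rewrite /determinant; apply: smooth_sum => s _; apply: smoothZ.
by apply: smooth_prod => i _.
Qed.

Lemma smooth_adj k (A : V -> 'M[R]_k) i j :
  (forall i j, smooth_at0 (fun z => A z i j)) -> smooth_at0 (fun z => \adj (A z) i j).
Proof.
move=> sA; rewrite (_ : (fun=> _) = fun z => cofactor (A z) j i); last first.
  by apply/funext => z; rewrite mxE.
rewrite /cofactor; apply: smoothZ; apply: smooth_det => i' j'.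
rewrite (_ : (fun=> _) = fun z => A z (lift j i') (lift i j')) //.
by apply/funext => z; rewrite !mxE.
Qed.

(** Vanishing of the (k-1)-jet at 0, that is, f = O(|x|^k) for smooth f. *)
Fixpoint flat_at0 k f : Prop :=
  if k is k'.+1 then f 0 = 0 /\ forall c, flat_at0 k' (partial c f) else True.

Lemma flat_near k f g : (\forall x \near (0 : V), f x = g x) -> flat_at0 k f -> flat_at0 k g.
Proof.
elim: k f g => [//|k IH] f g fg [f0 df]; split.
  by rewrite -(nbhs_singleton fg).
by move=> c; exact: (IH _ _ (partial_near c fg) (df c)).
Qed.

Lemma flatD k f g : smooth_at0 f -> smooth_at0 g -> flat_at0 k f -> flat_at0 k g ->
  flat_at0 k (fun z => f z + g z).
Proof.
elim: k f g => [//|k IH] f g sf sg [f0 df] [g0 dg]; split.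
  by rewrite f0 g0 addr0.
move=> c; apply: (flat_near _ (IH _ _ (smooth_partial c sf)
  (smooth_partial c sg) (df c) (dg c))).
have := smooth_derivable sf; have := smooth_derivable sg.
by apply: filterS2 => x dgx dfx; rewrite partialD.
Qed.

Lemma flatZ k (a : R) f : smooth_at0 f -> flat_at0 k f -> flat_at0 k (fun z => a * f z).
Proof.
elim: k f => [//|k IH] f sf [f0 df]; split; first by rewrite f0 mulr0.
move=> c; apply: (flat_near _ (IH _ (smooth_partial c sf) (df c))).
apply: filterS (smooth_derivable sf) => x dfx.
rewrite partialM//.
by rewrite (partial_cst a c x) mulr0 addr0.
Qed.

Lemma flat_cst0 k : flat_at0 k (fun=> 0).
Proof.
elim: k => [//|k IH]; split => // c.
by apply: (flat_near _ IH); apply: near0W => x; rewrite partial_cst.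
Qed.

Lemma flat_sum k (T : Type) (r : seq T) (F : T -> V -> R) :
  (forall i, smooth_at0 (F i)) -> (forall i, flat_at0 k (F i)) ->
  flat_at0 k (fun z => \sum_(i <- r) F i z).
Proof.
move=> sF fF; elim: r => [|i r IH].
  rewrite (_ : (fun=> _) = fun=> 0); first exact: flat_cst0.
  by apply/funext => z; rewrite big_nil.
rewrite (_ : (fun=> _) = fun z => F i z + \sum_(i <- r) F i z); last first.
  by apply/funext => z; rewrite big_cons.
by apply: flatD => //; exact: smooth_sum.
Qed.

(** By the Leibniz rule, a partial derivative of x_d f is the sum of a multiple of f
    and of x_d f', for f' a partial derivative of f. Differentiation costs f' one
    order of flatness, and the factor x_d gives it back by induction. *)
Lemma flat_coordM k d f : smooth_at0 f -> flat_at0 k f ->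
  flat_at0 k.+1 (fun z => z d.1 d.2 * f z).
Proof.
elim: k f => [|k IH] f sf ff; split => //=; rewrite ?mxE ?mul0r//.
move=> c; have [f0 df] := ff.
have h := flatD (smoothM (smooth_coord d) (smooth_partial c sf))
  (smoothZ (c == d)%:R sf) (IH _ (smooth_partial c sf) (df c)) (flatZ _ sf ff).
apply: (flat_near _ h); apply: filterS (smooth_derivable sf) => x dfx.
rewrite partialM//; last by move=> e; have [] := is_derive_coord d (delta_mx e.1 e.2) x.
by rewrite partial_coord [f x * _]mulrC.
Qed.

Definition partials l f := foldr (fun c => partial c) f l.

(** Through this list of coordinates the derivative of multi-index alpha becomes a
    chain of [partials], whose length is to be compared with an order of flatness. *)
Definition exponent_seq (alpha : I -> nat) : seq I :=
  flatten [seq nseq (alpha c) c | c <- enum {: I}].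

Lemma mderiveE alpha f : mderive alpha f = partials (exponent_seq alpha) f.
Proof.
rewrite /mderive /partials /exponent_seq.
elim: (enum _) => //= c l ->; rewrite foldr_cat.
by elim: (alpha c) => //= n ->.
Qed.

Lemma size_exponent_seq alpha : size (exponent_seq alpha) = \sum_c alpha c.
Proof.
rewrite size_flatten /shape -map_comp sumnE big_map.
by rewrite -big_enum /=; apply: eq_bigr => c _; rewrite size_nseq.
Qed.

Lemma smooth_partials l f : smooth_at0 f -> smooth_at0 (partials l f).
Proof. by move=> sf; elim: l => //= c l IH; exact: smooth_partial. Qed.

Lemma partials_near l f g : (\forall x \near (0 : V), f x = g x) ->
  \forall x \near (0 : V), partials l f x = partials l g x.
Proof. by move=> fg; elim: l => //= c l IH; exact: partial_near. Qed.

Lemma partialsD l f g : smooth_at0 f -> smooth_at0 g ->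
  \forall x \near (0 : V), partials l (fun z => f z + g z) x = partials l f x + partials l g x.
Proof.
move=> sf sg; elim: l => [|c l IH] /=; first exact: near0W.
have := smooth_derivable (smooth_partials l sf).
have := smooth_derivable (smooth_partials l sg).
have := partial_near c IH.
by apply: filterS3 => x -> dg df; rewrite partialD.
Qed.

Lemma flat_partials k l f : flat_at0 k f -> (size l < k)%N -> partials l f 0 = 0.
Proof.
elim/last_ind: l k f => [|l c IH] [|k] f //= []; first by [].
by move=> f0 df; rewrite size_rcons ltnS /partials foldr_rcons => /(IH k _ (df c)).
Qed.

Lemma mderiveD alpha f g : smooth_at0 f -> smooth_at0 g ->
  mderive alpha (fun z => f z + g z) 0 = mderive alpha f 0 + mderive alpha g 0.
Proof.
by move=> sf sg; rewrite !mderiveE; exact: nbhs_singleton (partialsD _ sf sg).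
Qed.

(** Flat terms do not contribute to a Taylor polynomial of lower degree. *)
Lemma mderive_flat k alpha f g : smooth_at0 g -> flat_at0 k g -> (\sum_c alpha c < k)%N ->
  smooth_at0 f -> mderive alpha (fun z => f z + g z) 0 = mderive alpha f 0.
Proof.
move=> sg fg ak sf; rewrite mderiveD// (mderiveE alpha g).
by rewrite (flat_partials fg) ?addr0// size_exponent_seq.
Qed.

Lemma mderive_near alpha f g : (\forall x \near (0 : V), f x = g x) ->
  mderive alpha f 0 = mderive alpha g 0.
Proof.
by move=> fg; rewrite !mderiveE; exact: nbhs_singleton (partials_near _ fg).
Qed.

End smooth_near_zero.

(** * Taylor polynomials of polynomials with nonnegative coefficients *)

Section positive_polynomials.
Context {R : realType} {p q : nat}.
Local Notation V := 'M[R]_(p.+1, q.+1).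
Local Notation I := ('I_p.+1 * 'I_q.+1)%type.
Implicit Types (f g : V -> R) (x : V) (c d : I) (K : nat) (l : seq I).
Implicit Types (alpha beta : I -> nat) (a : R).

Lemma is_derive_invariant f (v x : V) :
  (forall h, f (h *: v + x) = f x) -> is_derive x v f 0.
Proof.
move=> finv.
have h : (fun h : R => h^-1 *: (f (h *: v + x) - f x)) @ 0^' --> (0 : R).
  rewrite (_ : (fun h : R => _) = fun=> 0); first exact: cvg_cst.
  by apply/funext => h; rewrite finv subrr scaler0.
apply: DeriveDef; first by apply/cvg_ex; exists 0.
exact: cvg_lim h.
Qed.

Lemma partial_mpow a beta c :
  partial c (fun x => a * mpow x beta) =
  fun x => (a * (beta c)%:R) * mpow x (fun d => beta d - (d == c))%N.
Proof.
apply/funext => x.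
pose g (z : V) : R := \prod_(d | d != c) z d.1 d.2 ^+ beta d.
have mE b (z : V) : mpow z b =
    z c.1 c.2 ^+ b c * \prod_(d | d != c) z d.1 d.2 ^+ b d.
  by rewrite /mpow (bigD1 c).
have -> : (fun z => a * mpow z beta) = fun z => z c.1 c.2 ^+ beta c * (a * g z).
  by apply/funext => z; rewrite mE mulrCA.
have dg : is_derive x (delta_mx c.1 c.2) (fun z => a * g z) 0.
  apply: is_derive_invariant => h; congr (_ * _); apply: eq_bigr => d dc.
  rewrite !mxE -[_ && _]/((d.1, d.2) == (c.1, c.2)) -!surjective_pairing.
  by rewrite (negbTE dc) mulr0 add0r.
rewrite mE eqxx /=.
have -> : \prod_(d | d != c) x d.1 d.2 ^+ (beta d - (d == c)) = g x.
  by apply: eq_bigr => d /negbTE ->; rewrite subn0.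
case: (beta c) => [|n].
  rewrite mulr0 mul0r (_ : (fun z => _) = fun z => a * g z); last first.
    by apply/funext => z; rewrite expr0 mul1r.
  exact: derive_val.
have dX := @is_deriveX _ _ (fun z : V => z c.1 c.2) n.+1 x _ _
  (is_derive_coord c (delta_mx c.1 c.2) x).
have dM := is_deriveM dX dg.
rewrite /partial (_ : (fun z => _) =
  ((fun z : V => z c.1 c.2) ^+ n.+1) * (fun z => a * g z)); last first.
  by apply/funext => z; rewrite /= exprfctE.
rewrite (@derive_val _ _ _ _ _ _ _ dM) !mxE !eqxx scaler0 add0r subn1 /=.
by rewrite /GRing.scale /= mulr1 mulrC; lra.
Qed.

Lemma iter_partial_mpow a beta c n :
  iter n (partial c) (fun x => a * mpow x beta) =
  fun x => (a * (beta c ^_ n)%:R) * mpow x (fun d => beta d - n * (d == c))%N.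
Proof.
elim: n => [|n IH].
  apply/funext => x; rewrite /= ffactn0 mulr1; congr (_ * mpow x _).
  by apply/funext => d; rewrite mul0n subn0.
rewrite iterS IH partial_mpow; apply/funext => x; rewrite eqxx muln1.
rewrite ffactnSr natrM mulrA; congr (_ * mpow x _).
by apply/funext => d; rewrite mulSn -subnDA addnC.
Qed.

Lemma mderive_mpow alpha a beta :
  mderive alpha (fun x => a * mpow x beta) =
  fun x => (a * (\prod_c beta c ^_ alpha c)%N%:R) *
           mpow x (fun d => beta d - alpha d)%N.
Proof.
suff foldrE l : uniq l ->
    foldr (fun c g => iter (alpha c) (partial c) g) (fun x => a * mpow x beta) l =
    fun x => (a * (\prod_(c <- l) beta c ^_ alpha c)%N%:R) *
           mpow x (fun d => beta d - (d \in l) * alpha d)%N.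
  rewrite /mderive foldrE ?enum_uniq//; apply/funext => x.
  rewrite big_enum; congr (_ * mpow x _).
  by apply/funext => d; rewrite mem_enum mul1n.
elim: l => [|c l IH] /= => [_|/andP[cl ul]].
  apply/funext => x; rewrite big_nil mulr1; congr (_ * mpow x _).
  by apply/funext => d; rewrite mul0n subn0.
rewrite (IH ul) iter_partial_mpow; apply/funext => x.
rewrite (negbTE cl) mul0n subn0 big_cons [in RHS]mulnC natrM mulrA.
congr (_ * mpow x _); apply/funext => d; rewrite inE.
by case: eqP => [->|_]; rewrite ?(negbTE cl) ?muln1 ?mul0n ?subn0 ?muln0 ?mul1n ?subn0.
Qed.

(** At 0 the derivatives pick out coefficients: if alpha exceeds beta at some
    coordinate a falling factorial vanishes, and if it is smaller at some
    coordinate that coordinate is left as a factor. *)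
Lemma mderive_mpow0 alpha a beta :
  mderive alpha (fun x => a * mpow x beta) 0 =
  if [forall c, alpha c == beta c] then a * (mfact alpha)%:R else 0.
Proof.
rewrite mderive_mpow; case: ifPn => [/forallP ab|].
  rewrite /mpow [X in _ * X]big1 ?mulr1 => [|c _]; last by rewrite (eqP (ab c)) subnn.
  congr (_ * _%:R); apply: eq_bigr => c _.
  by rewrite (eqP (ab c)) ffactnn.
rewrite negb_forall => /existsP[c]; rewrite neq_ltn => /orP[ab|ba].
  rewrite /mpow [X in _ * X](bigD1 c)//= mxE expr0n.
  by rewrite subn_eq0 leqNgt ab mul0r mulr0.
by rewrite (bigD1 c)//= (ffact_small ba) mul0n mulr0 mul0r.
Qed.

Definition taylor_poly K f x : R :=
  \sum_(i < K.+1)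
    \sum_(alpha : {ffun I -> 'I_i.+1} | (\sum_c alpha c == i)%N)
      mderive (fun c => alpha c) f 0 / (mfact (fun c => alpha c))%:R *
      mpow x (fun c => alpha c).

Lemma mfact_neq0 alpha : (mfact alpha)%:R != 0 :> R.
Proof.
rewrite pnatr_eq0 -lt0n /mfact; elim/big_ind : _ => //.
- by move=> *; rewrite muln_gt0; apply/andP.
- by move=> c _; exact: fact_gt0.
Qed.

Lemma taylor_poly_mpow K a beta x : (\sum_c beta c <= K)%N ->
  taylor_poly K (fun z => a * mpow z beta) x = a * mpow x beta.
Proof.
move=> bK; have bK1 : (\sum_c beta c < K.+1)%N by [].
rewrite /taylor_poly (bigD1 (Ordinal bK1))//= [X in _ + X]big1 ?addr0; last first.
  move=> i ib; apply: big1 => alpha /eqP ai; rewrite mderive_mpow0.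
  case: ifPn => [/forallP ab|_]; last by rewrite !mul0r.
  move/negP: ib; case; apply/eqP/val_inj => /=; rewrite -ai.
  by apply: eq_bigr => c _; apply/eqP.
have bc c : (beta c < (\sum_c beta c).+1)%N.
  by rewrite ltnS (bigD1 c)//= leq_addr.
pose al : {ffun I -> 'I_(\sum_c beta c).+1} := [ffun c => Ordinal (bc c)].
have alE : (fun c => al c : nat) = beta by apply/funext => c; rewrite ffunE.
rewrite (bigD1 al) /=; last by apply/eqP/eq_bigr => c _; rewrite ffunE.
rewrite [X in _ + X]big1 ?addr0 => [|alpha /andP[_ ne]]; last first.
  rewrite mderive_mpow0; case: ifPn => [/forallP ab|_]; last by rewrite !mul0r.
  move/eqP : ne; case; apply/ffunP => c; apply: val_inj.
  by rewrite ffunE /=; apply/eqP.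
have E (b : I -> nat) : b = beta ->
    mderive b (fun z => a * mpow z beta) 0 / (mfact b)%:R * mpow x b =
    a * mpow x beta.
  move=> ->; rewrite mderive_mpow0; case: ifPn => [_|]; last by move/forallP; case.
  by rewrite mulfK// mfact_neq0.
exact: E alE.
Qed.

Lemma taylor_polyD K f g x : smooth_at0 f -> smooth_at0 g ->
  taylor_poly K (fun z => f z + g z) x = taylor_poly K f x + taylor_poly K g x.
Proof.
move=> sf sg; rewrite /taylor_poly -big_split; apply: eq_bigr => i _ /=.
rewrite -big_split; apply: eq_bigr => alpha _ /=.
by rewrite mderiveD// !mulrDl.
Qed.

(** Polynomials of degree at most K with nonnegative coefficients. The sign
    condition makes the Taylor polynomial with absolute values coincide with the
    ordinary one on nonnegative arguments. *)
Inductive pospoly K : (V -> R) -> Prop :=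
| pospoly0 : pospoly K (fun=> 0)
| pospoly_cons a beta f : 0 <= a -> (\sum_c beta c <= K)%N -> pospoly K f ->
    pospoly K (fun x => a * mpow x beta + f x).

Lemma smooth_mpow a beta : smooth_at0 (fun x => a * mpow x beta).
Proof.
apply: smoothZ; apply: smooth_prod => c _.
elim: (beta c) => [|n IH]; first exact: smooth_cst.
rewrite (_ : (fun z => _) = fun z : V => z c.1 c.2 * z c.1 c.2 ^+ n).
  by apply: smoothM => //; exact: smooth_coord.
by apply/funext => z; rewrite exprS.
Qed.

Lemma pospoly_smooth K f : pospoly K f -> smooth_at0 f.
Proof.
elim=> [|a beta g _ _ _ sg]; first exact: smooth_cst.
by apply: smoothD => //; exact: smooth_mpow.
Qed.

Lemma pospolyE K f g : f =1 g -> pospoly K f -> pospoly K g.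
Proof. by move=> /funext ->. Qed.

Lemma pospolyD K f g : pospoly K f -> pospoly K g ->
  pospoly K (fun x => f x + g x).
Proof.
move=> pf pg; elim: pf => [|a beta f' a0 bK pf' IH].
  by apply: pospolyE pg => x; rewrite add0r.
by apply: pospolyE (pospoly_cons a0 bK IH) => x; rewrite addrA.
Qed.

Lemma pospolyZ K a f : 0 <= a -> pospoly K f -> pospoly K (fun x => a * f x).
Proof.
move=> a0; elim=> [|b beta f' b0 bK pf' IH].
  by apply: pospolyE (pospoly0 K) => x; rewrite mulr0.
apply: pospolyE (pospoly_cons (mulr_ge0 a0 b0) bK IH) => x.
by rewrite mulrDr mulrA.
Qed.

Lemma pospolyW K L f : (K <= L)%N -> pospoly K f -> pospoly L f.
Proof.
move=> KL; elim=> [|b beta f' b0 bK pf' IH]; first exact: pospoly0.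
by apply: pospoly_cons => //; exact: leq_trans bK KL.
Qed.

Lemma pospoly_cst K a : 0 <= a -> pospoly K (fun=> a).
Proof.
move=> a0.
have := @pospoly_cons K a (fun=> 0%N) _ a0 _ (pospoly0 K).
rewrite big1// => /(_ isT); apply: pospolyE => x.
by rewrite /mpow big1 ?mulr1 ?addr0.
Qed.

Lemma pospoly_sum K (T : Type) (r : seq T) (F : T -> V -> R) :
  (forall i, pospoly K (F i)) -> pospoly K (fun z => \sum_(i <- r) F i z).
Proof.
move=> pF; elim: r => [|i r IH].
  by apply: pospolyE (pospoly0 K) => z; rewrite big_nil.
by apply: pospolyE (pospolyD (pF i) IH) => z; rewrite big_cons.
Qed.

Lemma pospoly_coordM K d f : pospoly K f ->
  pospoly K.+1 (fun z => z d.1 d.2 * f z).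
Proof.
elim=> [|b beta f' b0 bK pf' IH].
  by apply: pospolyE (pospoly0 _) => x; rewrite mulr0.
have bK1 : (\sum_c (beta c + (c == d)) <= K.+1)%N.
  by rewrite big_split /= -big_mkcond /= big_pred1_eq addn1.
apply: pospolyE (pospoly_cons b0 bK1 IH) => x; rewrite mulrDr mulrCA.
congr (_ * _ + _); rewrite /mpow; under eq_bigr do rewrite exprD.
rewrite big_split /= mulrC; congr (_ * _).
rewrite (bigD1 d)//= eqxx expr1 big1 ?mulr1// => c /negbTE ->.
by rewrite expr0.
Qed.

Lemma taylor_poly_pospoly K f x : pospoly K f -> taylor_poly K f x = f x.
Proof.
elim=> [|a beta g a0 bK pg IH].
  rewrite /taylor_poly big1// => i _; apply: big1 => alpha _.
  have := mderive_mpow0 (fun c => alpha c) 0 (fun=> 0%N).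
  rewrite (_ : (fun x => _) = fun=> 0); last by apply/funext => z; rewrite mul0r.
  by move=> ->; rewrite mul0r if_same !mul0r.
rewrite taylor_polyD ?IH ?taylor_poly_mpow//; first exact: smooth_mpow.
exact: pospoly_smooth pg.
Qed.

Lemma mderive_pospoly_ge0 K f alpha : pospoly K f -> 0 <= mderive alpha f 0.
Proof.
elim=> [|a beta g a0 bK pg IH].
  have := mderive_mpow0 alpha 0 (fun=> 0%N).
  rewrite (_ : (fun x => _) = fun=> 0); last by apply/funext => z; rewrite mul0r.
  by move=> ->; rewrite mul0r if_same.
rewrite mderiveD ?addr_ge0//; last 2 first.
- exact: smooth_mpow.
- exact: pospoly_smooth pg.
by rewrite mderive_mpow0; case: ifP => // _; rewrite mulr_ge0.
Qed.

Section expansion.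
Context K (f P g : V -> R).
Hypotheses (fE : \forall x \near (0 : V), f x = P x + g x)
  (pP : pospoly K P) (sg : smooth_at0 g) (fg : flat_at0 K.+1 g).

Let mderiveP (i : 'I_K.+1) alpha : (\sum_c alpha c = i)%N ->
  mderive alpha f 0 = mderive alpha P 0.
Proof.
move=> ai; rewrite (mderive_near _ fE).
by rewrite (mderive_flat sg fg)// ?ai//; exact: pospoly_smooth pP.
Qed.

(** A splitting f = P + g near 0, with P of degree at most K and g flat to order
    K + 1, identifies P as the Taylor polynomial of f, whatever x is: P is global
    although the splitting is local. *)
Lemma taylor_rem_expansion x : taylor_rem K f 0 x = f x - P x.
Proof.
rewrite -(taylor_poly_pospoly x pP) /taylor_rem subr0; congr (_ - _).
apply: eq_bigr => i _; apply: eq_bigr => alpha /eqP ai.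
by rewrite (mderiveP ai).
Qed.

Lemma taylor_abs_expansion x : (forall c, 0 <= x c.1 c.2) ->
  taylor_abs K f 0 x = P x.
Proof.
move=> x0; rewrite -(taylor_poly_pospoly x pP).
rewrite /taylor_abs (_ : absmx x + absmx 0 = x); last first.
  by apply/matrixP => i j; rewrite !mxE normr0 addr0 ger0_norm ?(x0 (i, j)).
apply: eq_bigr => i _; apply: eq_bigr => alpha /eqP ai.
by rewrite (mderiveP ai) ger0_norm// (mderive_pospoly_ge0 _ pP).
Qed.

End expansion.

End positive_polynomials.

(** * Contractions and the Bellman equations *)

(** Maximum principle: at a minimum of v, if v is negative there, the inequality
    gives v >= th v, which is impossible as th < 1. *)
Lemma superharmonic_ge0 (R : realType) (T : finType) (K : T -> T -> R) (th : R)
    (v : T -> R) :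
  (forall x y, 0 <= K x y) -> (forall x, \sum_y K x y <= th) -> th < 1 ->
  (forall x, \sum_y K x y * v y <= v x) -> forall x, 0 <= v x.
Proof.
move=> K0 Kth th1 vK x.
case: (@arg_minP _ _ T x xpredT v isT) => x0 _ vmin.
apply: le_trans (vmin x isT); rewrite leNgt; apply/negP => v0.
have : \sum_y K x0 y * v x0 <= v x0.
  by apply: le_trans (vK x0); apply: ler_sum => y _; rewrite ler_wpM2l// vmin.
rewrite -mulr_suml => h.
have : th * v x0 <= v x0 by apply: le_trans h; rewrite ler_wnM2r// ltW.
by rewrite -subr_ge0 -{1}[v x0]mul1r -mulrBl pmulr_rge0 ?subr_gt0// leNgt v0.
Qed.

(** If N u = u then - |u| is superharmonic for the kernel |N|, hence u = 0 by
    the maximum principle. *)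
Lemma unitmx_row_contraction (R : realType) k (N : 'M[R]_k) (th : R) :
  (forall i, \sum_j `|N i j| <= th) -> th < 1 -> 1%:M - N \in unitmx.
Proof.
move=> Nth th1; rewrite -unitmx_tr -row_free_unit -kermx_eq0; apply/eqP/row_matrixP => i.
rewrite row0; set u := row i _.
have : u *m (1%:M - N)^T = 0 by apply/sub_kermxP; exact: row_sub.
clearbody u; rewrite linearB /= trmx1 mulmxBr mulmx1 => /eqP; rewrite subr_eq0 => /eqP uN.
have uE j : u 0 j = \sum_l N j l * u 0 l.
  by rewrite {1}uN [LHS]mxE; apply: eq_bigr => l _; rewrite [X in _ * X]mxE mulrC.
(* the vector u spans a relation between the columns of 1 - N; - |u| is superharmonic *)
have h := @superharmonic_ge0 R 'I_k (fun j l => `|N j l|) th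
  (fun j => - `|u 0 j|) (fun _ _ => normr_ge0 _) Nth th1.
apply/rowP => j; rewrite [RHS]mxE; apply/eqP; rewrite -normr_le0 -oppr_ge0.
apply: h => {}j; rewrite [X in `|X|]uE.
rewrite (eq_bigr (fun l => - (`|N j l| * `|u 0 l|))) => [|l _]; last by rewrite mulrN.
rewrite sumrN lerN2; apply: le_trans (ler_norm_sum _ _ _) _.
by apply: ler_sum => l _; rewrite normrM.
Qed.

Section bellman.
Context {R : realType} {n m : nat}.
Implicit Types (M : mdp R n m) (pi q : 'M[R]_(n.+1, m.+1)).
Local Notation SA := ('I_n.+1 * 'I_m.+1)%type.
Implicit Types (f g : SA -> R) (x y : SA).

Definition backup M pi f x : R := \sum_y step M pi x y * f y.

Definition cost_of M x := cost M x.1 x.2.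

(** The domain on which the Bellman operator is a contraction: it contains the
    policies and a neighborhood of 0. *)
Definition substochastic pi := forall s, \sum_a `|pi s a| <= 1.

Lemma discount_ge0 M : 0 <= discount M.
Proof. by have /andP[] := discount01 M. Qed.

Lemma discount_lt1 M : discount M < 1.
Proof. by have /andP[] := discount01 M. Qed.

Lemma trans_ge0 M s a s' : 0 <= trans M s a s'.
Proof. by have [] := trans_distr M s a. Qed.

Lemma simplex_ge0 pi s a : prod_simplex R n.+1 m.+1 pi -> 0 <= pi s a.
Proof. by move=> /(_ s)[]. Qed.

Lemma simplex_sum1 pi s : prod_simplex R n.+1 m.+1 pi -> \sum_a pi s a = 1.
Proof. by move=> /(_ s)[]. Qed.

Lemma simplex_substochastic pi : prod_simplex R n.+1 m.+1 pi -> substochastic pi.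
Proof.
move=> dpi s; rewrite -(simplex_sum1 s dpi).
by apply: ler_sum => a _; rewrite ger0_norm// simplex_ge0.
Qed.

Definition state_trans M pi : 'M[R]_n.+1 :=
  \matrix_(s, s') \sum_a pi s a * trans M s a s'.

(** The inverse of this matrix is the resolvent: its rows are the unnormalized
    discounted occupation measures of the states. *)
Definition resolvent_inv M pi : 'M[R]_n.+1 := 1%:M - discount M *: state_trans M pi.

Lemma state_trans_row M pi s : substochastic pi ->
  \sum_s' `|(discount M *: state_trans M pi) s s'| <= discount M.
Proof.
move=> spi; under eq_bigr do rewrite mxE normrM (ger0_norm (discount_ge0 M)).
rewrite -mulr_sumr -[leRHS]mulr1 ler_wpM2l ?discount_ge0//.
apply: le_trans (spi s).
have -> : \sum_a `|pi s a| = \sum_s' \sum_a `|pi s a| * trans M s a s'.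
  rewrite exchange_big; apply: eq_bigr => a _.
  by rewrite -mulr_sumr (trans_distr M s a).2 mulr1.
apply: ler_sum => s' _; rewrite mxE; apply: le_trans (ler_norm_sum _ _ _) _.
by apply: ler_sum => a _; rewrite normrM [X in _ * X]ger0_norm// trans_ge0.
Qed.

Lemma resolvent_unit M pi : substochastic pi -> resolvent_inv M pi \in unitmx.
Proof.
move=> spi; apply: (@unitmx_row_contraction _ _ _ (discount M)).
  by move=> s; exact: state_trans_row.
exact: discount_lt1.
Qed.

Definition policy_cost M pi : 'cV[R]_n.+1 :=
  \col_s ((1 - discount M) * \sum_a pi s a * cost M s a).

Definition average pi q : 'cV[R]_n.+1 := \col_s \sum_a pi s a * q s a.

Definition lookahead M (v : 'cV[R]_n.+1) : 'M[R]_(n.+1, m.+1) :=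
  \matrix_(s, a) ((1 - discount M) * cost M s a +
                  discount M * \sum_s' trans M s a s' * v s' 0).

(** The Bellman equations for q amount to a fixpoint equation for the column of
    its state averages, an (n+1)-dimensional linear system. *)
Lemma bellmanE M pi q : bellman M pi q <-> q = lookahead M (average pi q).
Proof.
have E s a : \sum_s' \sum_a' trans M s a s' * pi s' a' * q s' a' =
    \sum_s' trans M s a s' * average pi q s' 0.
  apply: eq_bigr => s' _; rewrite mxE mulr_sumr.
  by apply: eq_bigr => a' _; rewrite mulrA.
split=> [bq|qE s a]; first by apply/matrixP => s a; rewrite mxE bq E.
by rewrite {1}qE mxE E.
Qed.

Lemma average_lookahead M pi v :
  average pi (lookahead M v) = policy_cost M pi + (discount M *: state_trans M pi) *m v.
Proof.
apply/colP => s; rewrite !mxE.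
under eq_bigr do rewrite mxE mulrDr.
rewrite big_split /= mulr_sumr; congr (_ + _).
  by apply: eq_bigr => a _; rewrite mulrCA.
under [RHS]eq_bigr do rewrite !mxE mulr_sumr mulr_suml.
rewrite exchange_big /=; apply: eq_bigr => a _.
rewrite !mulr_sumr; apply: eq_bigr => s' _; ring.
Qed.

Definition bellman_sol M pi := lookahead M (invmx (resolvent_inv M pi) *m policy_cost M pi).

Lemma average_fixpoint M pi (v : 'cV[R]_n.+1) : substochastic pi ->
  v = policy_cost M pi + (discount M *: state_trans M pi) *m v <->
  v = invmx (resolvent_inv M pi) *m policy_cost M pi.
Proof.
move=> spi; have U := resolvent_unit M spi; split=> [vE|->].
  have : resolvent_inv M pi *m v = policy_cost M pi.
    by rewrite /resolvent_inv mulmxBl mul1mx {1}vE addrK.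
  by move=> <-; rewrite mulKmx.
set w := _ *m _; have : resolvent_inv M pi *m w = policy_cost M pi by rewrite mulKVmx.
by rewrite /resolvent_inv mulmxBl mul1mx => <-; rewrite subrK.
Qed.

Lemma bellman_solP M pi q : substochastic pi ->
  bellman M pi q <-> q = bellman_sol M pi.
Proof.
move=> spi; rewrite bellmanE; split=> [qE|->].
  have := average_lookahead M pi (average pi q); rewrite -qE.
  by move/(average_fixpoint M _ spi) => vE; rewrite qE vE.
rewrite /bellman_sol average_lookahead.
by rewrite -((average_fixpoint M _ spi).2 erefl).
Qed.

Lemma bellman_sol_bellman M pi : substochastic pi -> bellman M pi (bellman_sol M pi).
Proof. by move=> spi; apply/bellman_solP. Qed.

(** Action values as functions of a state-action pair, the points of the chain
    that [step] describes. *)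
Definition pairs q x := q x.1 x.2.

Lemma bellman_backup M pi q : bellman M pi q ->
  forall x, pairs q x = (1 - discount M) * cost_of M x + discount M * backup M pi (pairs q) x.
Proof.
move=> bq [s a]; rewrite /pairs [LHS]bq; congr (_ + _ * _).
by rewrite pair_bigA.
Qed.

Lemma backupD M pi f g x :
  backup M pi (fun y => f y + g y) x = backup M pi f x + backup M pi g x.
Proof. by rewrite -big_split; apply: eq_bigr => y _; rewrite mulrDr. Qed.

Lemma backupZ M pi (a : R) f x :
  backup M pi (fun y => a * f y) x = a * backup M pi f x.
Proof. by rewrite mulr_sumr; apply: eq_bigr => y _; rewrite mulrCA. Qed.

Lemma iter_backupD M pi t f g x :
  iter t (backup M pi) (fun y => f y + g y) x =
  iter t (backup M pi) f x + iter t (backup M pi) g x.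
Proof.
elim: t x => [//|t IH] x; rewrite !iterS -backupD; congr backup.
exact/funext.
Qed.

Lemma iter_backupZ M pi t (a : R) f x :
  iter t (backup M pi) (fun y => a * f y) x = a * iter t (backup M pi) f x.
Proof.
elim: t x => [//|t IH] x; rewrite !iterS -backupZ; congr backup.
exact/funext.
Qed.

(** Partial sum of the Neumann series of the action values. As a function of the
    policy it has degree at most N - 1, so N = K + 1 gives the terms of degree at most K. *)
Definition truncated_value N M pi x : R :=
  (1 - discount M) * \sum_(t < N) discount M ^+ t * iter t (backup M pi) (cost_of M) x.

(** Substituting the Bellman equation into itself N times. The identity is
    purely algebraic, so it holds at policies and near 0 alike. *)
Lemma bellman_expansion M pi q N x : bellman M pi q ->
  pairs q x = truncated_value N M pi x +
              discount M ^+ N * iter N (backup M pi) (pairs q) x.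
Proof.
move=> bq; rewrite /truncated_value; elim: N => [|N IH].
  by rewrite big_ord0 mulr0 add0r mul1r.
rewrite IH big_ord_recr /= mulrDr -addrA; congr (_ + _).
have -> : pairs q = fun y => (1 - discount M) * cost_of M y +
    discount M * backup M pi (pairs q) y by apply/funext => y; exact: bellman_backup.
rewrite iter_backupD !iter_backupZ -iterSr iterS -(funext (bellman_backup bq)).
by rewrite mulrDr exprSr mulrA [_ * (1 - _)]mulrC !mulrA.
Qed.

Lemma step_ge0 M pi x y : prod_simplex R n.+1 m.+1 pi -> 0 <= step M pi x y.
Proof. by move=> dpi; rewrite mulr_ge0 ?trans_ge0 ?simplex_ge0. Qed.

Lemma step_sum1 M pi x : prod_simplex R n.+1 m.+1 pi -> \sum_y step M pi x y = 1.
Proof.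
move=> dpi; rewrite -(pair_bigA _ (fun s a => trans M x.1 x.2 s * pi s a)) /=.
under eq_bigr do rewrite -mulr_sumr (simplex_sum1 _ dpi) mulr1.
exact: (trans_distr M _ _).2.
Qed.

Lemma iter_backup_itv01 M pi t f : prod_simplex R n.+1 m.+1 pi ->
  (forall x, 0 <= f x <= 1) -> forall x, 0 <= iter t (backup M pi) f x <= 1.
Proof.
move=> dpi f01; elim: t => [//|t IH] x; rewrite iterS /backup; apply/andP; split.
  by apply: sumr_ge0 => y _; rewrite mulr_ge0 ?step_ge0//; case/andP: (IH y).
rewrite -(step_sum1 M x dpi); apply: ler_sum => y _.
by rewrite -[leRHS]mulr1 ler_wpM2l ?step_ge0//; case/andP: (IH y).
Qed.

(** The maximum principle applied to q and to 1 - q. *)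
Lemma bellman_itv01 M pi q : prod_simplex R n.+1 m.+1 pi -> bellman M pi q ->
  forall x, 0 <= pairs q x <= 1.
Proof.
move=> dpi bq x; have bqE := bellman_backup bq.
have t0 := discount_ge0 M; have t1 := discount_lt1 M.
have K0 y z : 0 <= discount M * step M pi y z by rewrite mulr_ge0 ?step_ge0.
have K1 y : \sum_z discount M * step M pi y z <= discount M.
  by rewrite -mulr_sumr step_sum1// mulr1.
have kb f y : \sum_z discount M * step M pi y z * f z = discount M * backup M pi f y.
  by rewrite mulr_sumr; apply: eq_bigr => z _; rewrite mulrA.
apply/andP; split.
  apply: (superharmonic_ge0 K0 K1 t1) => y; rewrite kb [leRHS]bqE lerDr mulr_ge0//.
    by rewrite subr_ge0 ltW.
  by case/andP: (cost01 M y.1 y.2).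
rewrite -subr_ge0; apply: (superharmonic_ge0 (v := fun y => 1 - pairs q y) K0 K1 t1) => y.
rewrite kb [in leRHS]bqE.
have -> : (fun z => 1 - pairs q z) = fun z => (fun=> 1) z + (-1) * pairs q z.
  by apply/funext => z; rewrite mulN1r.
rewrite backupD backupZ.
have -> : backup M pi (fun=> 1) y = 1.
  by rewrite /backup; under eq_bigr do rewrite mulr1; rewrite step_sum1.
have /andP[_ c1] := cost01 M y.1 y.2.
have : (1 - discount M) * cost_of M y <= (1 - discount M) * 1.
  by rewrite ler_wpM2l// subr_ge0 ltW.
by lra.
Qed.

Lemma truncated_value_ge0 N M pi x : prod_simplex R n.+1 m.+1 pi ->
  0 <= truncated_value N M pi x.
Proof.
move=> dpi; apply: mulr_ge0; first by rewrite subr_ge0 ltW ?discount_lt1.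
apply: sumr_ge0 => t _; rewrite mulr_ge0 ?exprn_ge0 ?discount_ge0//.
have c01 y : 0 <= cost_of M y <= 1 by exact: cost01.
by case/andP: (iter_backup_itv01 M t dpi c01 x).
Qed.

Lemma truncated_value_err N M pi q x : prod_simplex R n.+1 m.+1 pi ->
  bellman M pi q -> 0 <= pairs q x - truncated_value N M pi x <= discount M ^+ N.
Proof.
move=> dpi bq; rewrite (bellman_expansion N x bq) addrAC subrr add0r.
have /andP[h0 h1] := iter_backup_itv01 M N dpi (bellman_itv01 dpi bq) x.
have tN := exprn_ge0 N (discount_ge0 M).
by rewrite mulr_ge0//= -[leRHS]mulr1 ler_wpM2l.
Qed.

End bellman.

(** * The expansion of the action values at zero *)

Section expansion_at_zero.
Context {R : realType} {n m : nat}.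
Local Notation V := 'M[R]_(n.+1, m.+1).
Implicit Types (M : mdp R n m) (pi q : V).
Local Notation SA := ('I_n.+1 * 'I_m.+1)%type.

(** Small matrices have row sums less than 1, hence are not policies: there the
    extension [Qext] is the solution of the Bellman equations. *)
Lemma near0_substochastic :
  \forall pi \near (0 : V), substochastic pi /\ ~ prod_simplex R n.+1 m.+1 pi.
Proof.
pose e : R := m.+2%:R^-1.
have e0 : 0 < e by rewrite invr_gt0 ltr0n.
have : nbhs (0 : V) (ball (0 : V) e) by exact: nbhsx_ballx.
apply: filterS => pi [_ bpi].
have pe s a : `|pi s a| <= e.
  by have := bpi s a; rewrite /ball/= mxE sub0r normrN => /ltW.
have lt1 s : \sum_a `|pi s a| < 1.
  apply: (@le_lt_trans _ _ (\sum_(a < m.+1) e)); first exact: ler_sum.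
  rewrite sumr_const card_ord -mulr_natl /e ltr_pdivrMr ?ltr0n// mul1r.
  by rewrite ltr_nat.
split=> [s|dpi]; first exact: ltW.
have := lt1 0; rewrite (eq_bigr (fun a => pi 0 a)) ?(simplex_sum1 _ dpi) ?ltxx//.
by move=> a _; rewrite ger0_norm// simplex_ge0.
Qed.

Lemma Qext_near0 M : \forall pi \near (0 : V), Qext M pi = bellman_sol M pi.
Proof.
apply: filterS near0_substochastic => pi [spi npi].
rewrite /Qext; case: (pselect _) => [dpi|ndpi]; first by case: (npi dpi).
apply: xget_unique.
  exact: bellman_sol_bellman.
by move=> q bq; exact: (bellman_solP M q spi).1.
Qed.

Lemma bellman_defined0 M : bellman_defined M 0.
Proof.
have s0 : substochastic (0 : V).
  by move=> s; rewrite big1 ?ler01// => a _; rewrite mxE normr0.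
exists (bellman_sol M 0); split; first exact: bellman_sol_bellman.
by move=> q bq; rewrite ((bellman_solP M q s0).1 bq).
Qed.

(** Near 0 the solution is a rational function, by Cramer's rule. *)
Lemma smooth_bellman_sol M s a : smooth_at0 (fun pi => bellman_sol M pi s a).
Proof.
pose sol pi : R := (1 - discount M) * cost M s a + discount M *
  \sum_s' trans M s a s' * \sum_s'' (\det (resolvent_inv M pi))^-1 *
    (\adj (resolvent_inv M pi) s' s'' * policy_cost M pi s'' 0).
apply: (@smooth_near _ _ _ sol).
  apply: filterS near0_substochastic => pi [spi _].
  rewrite /sol mxE; congr (_ + _ * _); apply: eq_bigr => s' _; congr (_ * _).
  rewrite /invmx resolvent_unit// mxE; apply: eq_bigr => s'' _.
  by rewrite !mxE mulrA.
have sr i j : smooth_at0 (fun pi => resolvent_inv M pi i j).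
  have -> : (fun pi => resolvent_inv M pi i j) = fun pi => (1%:M : 'M[R]_n.+1) i j +
      (- discount M) * \sum_a pi (i, a).1 (i, a).2 * trans M i a j.
    by apply/funext => pi; rewrite !mxE mulNr.
  apply: smoothD; first exact: smooth_cst.
  apply: smoothZ; apply: smooth_sum => b _.
  by apply: smoothM; [exact: (smooth_coord (i, b))|exact: smooth_cst].
apply: smoothD; first exact: smooth_cst.
apply: smoothZ; apply: smooth_sum => s' _; apply: smoothZ.
apply: smooth_sum => s'' _; apply: smoothM.
  apply: smoothV; last exact: smooth_det.
  apply: filterS near0_substochastic => pi [spi _].
  by have := resolvent_unit M spi; rewrite unitmxE unitfE.
apply: smoothM; first exact: smooth_adj.
have -> : (fun pi => policy_cost M pi s'' 0) = fun pi => (1 - discount M) *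
    \sum_a pi (s'', a).1 (s'', a).2 * cost M s'' a.
  by apply/funext => pi; rewrite !mxE.
apply: smoothZ; apply: smooth_sum => b _.
by apply: smoothM; [exact: (smooth_coord (s'', b))|exact: smooth_cst].
Qed.

Lemma pospoly_backup M k (F : V -> SA -> R) x :
  (forall y, pospoly k (fun pi => F pi y)) ->
  pospoly k.+1 (fun pi => backup M pi (F pi) x).
Proof.
move=> pF; apply: pospoly_sum => y.
apply: pospolyE (pospolyZ (trans_ge0 M x.1 x.2 y.1) (pospoly_coordM y (pF y))).
by move=> pi; rewrite /step mulrA.
Qed.

Lemma pospoly_iter_backup M t x :
  pospoly t (fun pi => iter t (backup M pi) (cost_of M) x).
Proof.
elim: t x => [|t IH] x /=; last exact: pospoly_backup.
by apply: pospoly_cst; case/andP: (cost01 M x.1 x.2).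
Qed.

Lemma pospoly_truncated_value K M x :
  pospoly K (fun pi => truncated_value K.+1 M pi x).
Proof.
apply: pospolyZ; first by rewrite subr_ge0 ltW// discount_lt1.
apply: pospoly_sum => t; apply: pospolyZ; first by rewrite exprn_ge0// discount_ge0.
by apply: pospolyW (pospoly_iter_backup M t x); rewrite -ltnS ltn_ord.
Qed.

Lemma smooth_backup M (F : V -> SA -> R) x :
  (forall y, smooth_at0 (fun pi => F pi y)) -> smooth_at0 (fun pi => backup M pi (F pi) x).
Proof.
move=> sF; apply: smooth_sum => y _; apply: smoothM => //.
by apply: smoothZ; exact: smooth_coord.
Qed.

(** One backup multiplies by entries of the policy, which raises by one the order
    of vanishing at 0. For the same reason it raises by one the degree of a
    polynomial ([pospoly_backup]). *)
Lemma flat_backup M k (F : V -> SA -> R) x :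
  (forall y, smooth_at0 (fun pi => F pi y)) -> (forall y, flat_at0 k (fun pi => F pi y)) ->
  flat_at0 k.+1 (fun pi => backup M pi (F pi) x).
Proof.
move=> sF fF; apply: flat_sum => y.
  by apply: smoothM => //; apply: smoothZ; exact: smooth_coord.
rewrite (_ : (fun pi => _) = fun pi : V => trans M x.1 x.2 y.1 * (pi y.1 y.2 * F pi y)).
  apply: flatZ; first by apply: smoothM => //; exact: smooth_coord.
  exact: flat_coordM.
by apply/funext => pi; rewrite /step mulrA.
Qed.

Lemma iter_backup_smooth_flat M t (F : V -> SA -> R) :
  (forall y, smooth_at0 (fun pi => F pi y)) -> forall x,
  smooth_at0 (fun pi => iter t (backup M pi) (F pi) x) /\
  flat_at0 t (fun pi => iter t (backup M pi) (F pi) x).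
Proof.
move=> sF; elim: t => [|t IH] x //=; split.
  by apply: smooth_backup => y; have [] := IH y.
by apply: flat_backup => y; have [] := IH y.
Qed.

Definition bellman_tail N M x pi : R :=
  discount M ^+ N * iter N (backup M pi) (pairs (bellman_sol M pi)) x.

Lemma bellman_tail_smooth_flat N M x :
  smooth_at0 (bellman_tail N M x) /\ flat_at0 N (bellman_tail N M x).
Proof.
have [sI fI] := @iter_backup_smooth_flat M N (fun pi => pairs (bellman_sol M pi))
  (fun y => smooth_bellman_sol M y.1 y.2) x.
by split; [exact: smoothZ|exact: flatZ].
Qed.

Lemma Qext_expansion K M x : \forall pi \near (0 : V),
  Qext M pi x.1 x.2 = truncated_value K.+1 M pi x + bellman_tail K.+1 M x pi.
Proof.
have := Qext_near0 M; apply: filterS2 near0_substochastic => pi [spi _] ->.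
by apply: bellman_expansion; exact: bellman_sol_bellman.
Qed.

(** This is an identity on the whole space of matrices: the Taylor polynomial
    is determined near 0, but the remainder is taken at any pi. *)
Lemma taylor_rem_Qext K M x pi :
  taylor_rem K (fun z => Qext M z x.1 x.2) 0 pi =
  Qext M pi x.1 x.2 - truncated_value K.+1 M pi x.
Proof.
have [st ft] := bellman_tail_smooth_flat K.+1 M x.
exact: (taylor_rem_expansion (Qext_expansion K M x) (pospoly_truncated_value K M x) st ft).
Qed.

Lemma taylor_abs_Qext K M x pi : prod_simplex R n.+1 m.+1 pi ->
  taylor_abs K (fun z => Qext M z x.1 x.2) 0 pi = truncated_value K.+1 M pi x.
Proof.
move=> dpi; have [st ft] := bellman_tail_smooth_flat K.+1 M x.
apply: (taylor_abs_expansion (Qext_expansion K M x) (pospoly_truncated_value K M x) st ft).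
by move=> c; exact: simplex_ge0.
Qed.

End expansion_at_zero.

(** * Discounted costs along trajectories *)

Section trajectories.
Context {R : realType} {n m : nat}.
Local Notation SA := ('I_n.+1 * 'I_m.+1)%type.
Implicit Types (M : mdp R n m) (pi q : 'M[R]_(n.+1, m.+1)) (f nu : SA -> R).

Definition cylinder (x : nat -> SA) (t : nat) : set (trajectory n m) :=
  [set w | forall k, (k <= t)%N -> w k = x k].

Lemma measurable_coord t y : measurable [set w : trajectory n m | w t = y].
Proof. by apply: sub_sigma_algebra; exists t, y. Qed.

Lemma measurable_coord_fun (f : SA -> R) t :
  measurable_fun setT (fun w : trajectory n m => f (w t)).
Proof.
move=> _ Y mY; rewrite setTI.
have -> : (fun w : trajectory n m => f (w t)) @^-1` Y =
    \bigcup_(y in [set y | Y (f y)]) [set w : trajectory n m | w t = y].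
  by apply/seteqP; split=> [w Yw|w [y Yy /= ->]] //; exists (w t).
by apply: fin_bigcup_measurable => [|y _]; [exact: finite_finset|exact: measurable_coord].
Qed.

Lemma measurable_cylinder x t : measurable (cylinder x t).
Proof.
have -> : cylinder x t = \bigcap_(k in [set k | (k <= t)%N]) [set w | w k = x k].
  by apply/seteqP; split=> w h k; [exact: h|exact: h].
apply: fin_bigcap_measurable => [|k _]; last exact: measurable_coord.
apply: (@sub_finite_set _ _ `I_t.+1); last exact: finite_II.
by move=> k /=; rewrite ltnS.
Qed.

Lemma measurable_cylinder_fun (f : SA -> R) x t s :
  measurable_fun setT (fun w : trajectory n m => (\1_(cylinder x t) w * f (w s))%:E).
Proof.
apply/measurable_EFinP; apply: measurable_funM.
  by apply: measurable_indic; exact: measurable_cylinder.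
exact: measurable_coord_fun.
Qed.

(** The cylinders of length t + 1 over [extend x t y], for varying y, partition
    that of length t over x. *)
Definition extend (x : nat -> SA) t y (k : nat) : SA := if k == t.+1 then y else x k.

Lemma indic_cylinder_extend x t y (w : trajectory n m) :
  \1_(cylinder (extend x t y) t.+1) w =
  \1_(cylinder x t) w * (w t.+1 == y)%:R :> R.
Proof.
rewrite !indicE -natrM mulnb; congr (nat_of_bool _)%:R.
apply/idP/andP => [/set_mem h|[/set_mem h /eqP wy]].
  split; last by apply/eqP; rewrite (h t.+1)// /extend eqxx.
  apply/mem_set => k kt; rewrite h ?leqW// /extend.
  by rewrite ltn_eqF// ltnS.
apply/mem_set => k; rewrite /extend leq_eqVlt => /orP[/eqP ->|].
  by rewrite eqxx.
by rewrite ltnS => kt; rewrite ltn_eqF ?ltnS//; exact: h.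
Qed.

Lemma sum_indic_eq (T : finType) (z : T) (F : T -> R) :
  \sum_y F y * (z == y)%:R = F z.
Proof.
rewrite (bigD1 z)//= eqxx mulr1 big1 ?addr0// => y; rewrite eq_sym => /negbTE ->.
by rewrite mulr0.
Qed.

(** Markov property: induction on the delay j, splitting the cylinder according
    to the next state-action pair, whose weights are those of a backup. *)
Lemma integral_cylinder M pi nu f x j t :
  prod_simplex R n.+1 m.+1 pi -> distr nu -> (forall y, 0 <= f y) ->
  (\int[law M pi nu]_w (\1_(cylinder x t) w * f (w (t + j)%N))%:E =
   (nu (x 0%N) * \prod_(k < t) step M pi (x k) (x k.+1) *
    iter j (backup M pi) f (x t))%:E)%E.
Proof.
move=> dpi dnu f0; elim: j t x => [|j IH] t x.
  rewrite addn0 (eq_integral (fun w => ((f (x t))%:E * (\1_(cylinder x t) w)%:E)%E)); last first.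
    move=> w _; rewrite -EFinM mulrC indicE.
    by case: (boolP (w \in cylinder x t)) => [/set_mem /(_ t (leqnn t)) ->|_]; rewrite ?mulr0.
  rewrite ge0_integralZl_EFin//; last first.
    by apply/measurable_EFinP; apply: measurable_indic; exact: measurable_cylinder.
  rewrite integral_indic//; last exact: measurable_cylinder.
  by rewrite setIT [in RHS]mulrC EFinM; congr (_ * _)%E; exact: (lawP M dpi dnu t x).
rewrite (eq_integral (fun w => (\sum_y
    (\1_(cylinder (extend x t y) t.+1) w * f (w (t.+1 + j)%N))%:E)%E)); last first.
  move=> w _; rewrite sumEFin addSnnS; congr EFin.
  under eq_bigr do rewrite indic_cylinder_extend mulrAC.
  by rewrite sum_indic_eq.
rewrite ge0_integral_sum//; last 2 first.
- by move=> y; exact: measurable_cylinder_fun.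
- by move=> y w _; rewrite lee_fin mulr_ge0.
under eq_bigr do rewrite IH.
rewrite sumEFin iterS /backup mulr_sumr; congr EFin; apply: eq_bigr => y _.
have extE k : (k <= t)%N -> extend x t y k = x k.
  by move=> kt; rewrite /extend ltn_eqF.
have ext_last : extend x t y t.+1 = y by rewrite /extend eqxx.
rewrite big_ord_recr /= ext_last !extE// !mulrA; congr (_ * _ * _ * _).
by congr (_ * _); apply: eq_bigr => k _; rewrite !extE// ltnW.
Qed.

Lemma integral_coord M pi nu f t :
  prod_simplex R n.+1 m.+1 pi -> distr nu -> (forall y, 0 <= f y) ->
  (\int[law M pi nu]_w (f (w t))%:E =
   (\sum_y nu y * iter t (backup M pi) f y)%:E)%E.
Proof.
move=> dpi dnu f0.
rewrite (eq_integral (fun w => (\sum_y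
    (\1_(cylinder (fun=> y) 0) w * f (w (0 + t)%N))%:E)%E)); last first.
  move=> w _; rewrite sumEFin add0n; congr EFin.
  rewrite -[LHS](sum_indic_eq (w 0%N) (fun=> f (w t))); apply: eq_bigr => y _.
  rewrite mulrC indicE; congr (_%:R * _); congr nat_of_bool.
  apply/eqP/idP => [<-|/set_mem /(_ 0%N)]; last exact.
  by apply/mem_set => k; rewrite leqn0 => /eqP ->.
rewrite ge0_integral_sum//; last 2 first.
- by move=> y; exact: measurable_cylinder_fun.
- by move=> y w _; rewrite lee_fin mulr_ge0.
under eq_bigr do rewrite integral_cylinder//.
by rewrite sumEFin; congr EFin; apply: eq_bigr => y _; rewrite big_ord0 mulr1.
Qed.

(** The series of discounted costs is integrated term by term, and its partial
    sums are the truncated values, which are within theta^N of the solution of the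
    Bellman equations. *)
Lemma expected_costE M pi nu q : prod_simplex R n.+1 m.+1 pi -> distr nu ->
  bellman M pi q -> expected_cost M pi nu = \sum_y nu y * pairs q y.
Proof.
move=> dpi dnu bq; have t0 := discount_ge0 M; have t1 := discount_lt1 M.
have d1 : 1 - discount M != 0 by rewrite subr_eq0 eq_sym lt_eqF.
have c0 y : 0 <= cost_of M y by case/andP: (cost01 M y.1 y.2).
rewrite /expected_cost.
have -> : (\int[law M pi nu]_w \sum_(0 <= t <oo)
      (discount M ^+ t * cost M (w t).1 (w t).2)%:E =
    \sum_(0 <= t <oo) (discount M ^+ t *
      \sum_y nu y * iter t (backup M pi) (cost_of M) y)%:E)%E.
  rewrite integral_nneseries//; last 2 first.
  - move=> t; apply/measurable_EFinP.
    exact: (measurable_coord_fun (fun y => discount M ^+ t * cost_of M y)).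
  - by move=> t w _; rewrite lee_fin; apply: mulr_ge0; [exact: exprn_ge0|exact: c0].
  apply: eq_eseriesr => t _.
  rewrite (integral_coord M t dpi dnu (f := fun y => discount M ^+ t * cost_of M y)).
    rewrite mulr_sumr; congr EFin; apply: eq_bigr => y _.
    by rewrite iter_backupZ mulrCA.
  by move=> y; rewrite mulr_ge0 ?exprn_ge0.
pose u N := \sum_y nu y * truncated_value N M pi y.
have uE N : \sum_(0 <= t < N) discount M ^+ t *
    \sum_y nu y * iter t (backup M pi) (cost_of M) y = (1 - discount M)^-1 * u N.
  rewrite /u /truncated_value; under [in RHS]eq_bigr do rewrite mulrCA.
  rewrite -mulr_sumr mulKf// big_mkord.
  under [in RHS]eq_bigr do rewrite mulr_sumr.
  rewrite exchange_big; apply: eq_bigr => t _; rewrite mulr_sumr.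
  by apply: eq_bigr => y _; rewrite mulrCA.
have u_cvg : u @ \oo --> \sum_y nu y * pairs q y.
  (* the average over nu of the truncation errors lies between 0 and theta^N *)
  apply: (@squeeze_cvgr _ _ _ _ (fun N => \sum_y nu y * pairs q y - discount M ^+ N)
    (fun=> \sum_y nu y * pairs q y)); last 2 first.
  - rewrite -[X in _ --> X]subr0; apply: cvgB; first exact: cvg_cst.
    by apply: cvg_expr; rewrite ger0_norm.
  - exact: cvg_cst.
  apply: nearW => N; apply/andP; split.
    rewrite lerBlDr -[X in _ + X]mul1r -dnu.2 mulr_suml -big_split.
    apply: ler_sum => y _ /=; rewrite -mulrDr ler_wpM2l ?dnu.1//.
    by have /andP[_] := truncated_value_err N y dpi bq; rewrite lerBlDl.
  apply: ler_sum => y _; rewrite ler_wpM2l ?dnu.1// -subr_ge0.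
  by have /andP[] := truncated_value_err N y dpi bq.
rewrite (@cvg_lim _ _ _ _ _ _ ((1 - discount M)^-1 * \sum_y nu y * pairs q y)%:E)//.
  by rewrite /= mulVKf.
apply: cvg_EFin; first by apply: nearW => N; rewrite sumEFin.
rewrite (_ : _ \o _ = fun N => (1 - discount M)^-1 * u N); last first.
  by apply/funext => N /=; rewrite sumEFin /= uE.
by apply: cvgM => //; exact: cvg_cst.
Qed.

Lemma Qvalue_bellman M pi : prod_simplex R n.+1 m.+1 pi -> bellman M pi (Qvalue M pi).
Proof.
move=> dpi; have bq := bellman_sol_bellman M (simplex_substochastic dpi).
suff -> : Qvalue M pi = bellman_sol M pi by [].
apply/matrixP => s a; rewrite mxE (expected_costE dpi _ bq).
  under eq_bigr do rewrite mulrC eq_sym.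
  by rewrite sum_indic_eq.
split=> [y|]; first exact: ler0n.
by rewrite -[RHS](sum_indic_eq (s, a) (fun=> 1)); apply: eq_bigr => y _; rewrite mul1r eq_sym.
Qed.

Lemma valueE M pi s : prod_simplex R n.+1 m.+1 pi ->
  value M pi s = average pi (Qvalue M pi) s 0.
Proof.
move=> dpi; have pick (F : SA -> R) :
    \sum_y (y.1 == s)%:R * pi y.1 y.2 * F y = \sum_a pi s a * F (s, a).
  rewrite (eq_bigr (fun y => (y.1 == s)%:R * pi y.1 y.2 * F (y.1, y.2))); last by case.
  rewrite -(pair_bigA _ (fun i a => (i == s)%:R * pi i a * F (i, a))) /=.
  rewrite (bigD1 s)//= [X in _ + X]big1 ?addr0 => [|i /negbTE is_]; last first.
    by rewrite big1// => a _; rewrite is_ !mul0r.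
  by apply: eq_bigr => a _; rewrite eqxx mul1r.
rewrite /value (expected_costE dpi _ (Qvalue_bellman M dpi)); first by rewrite pick mxE.
split=> [y|]; first by rewrite mulr_ge0 ?ler0n// simplex_ge0.
have := pick (fun=> 1); under eq_bigr do rewrite mulr1.
by move=> ->; under eq_bigr do rewrite mulr1; exact: simplex_sum1.
Qed.

End trajectories.

(** * Quasar-convexity *)

Section quasar.
Context {R : realType} {n m : nat}.
Implicit Types (M : mdp R n m) (pi q : 'M[R]_(n.+1, m.+1)).

Definition advantage M pi' pi : 'cV[R]_n.+1 :=
  \col_s \sum_a Qvalue M pi s a * (pi' s a - pi s a).

Definition state_values M pi : 'cV[R]_n.+1 := \col_s value M pi s.

(** Both sides satisfy the same linear system: v' - v is the immediate advantage
    of pi' over pi plus the discounted average of v' - v under pi'. *)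
Lemma performance_difference M pi' pi :
  prod_simplex R n.+1 m.+1 pi' -> prod_simplex R n.+1 m.+1 pi ->
  state_values M pi' - state_values M pi =
  invmx (resolvent_inv M pi') *m advantage M pi' pi.
Proof.
move=> dpi' dpi; have U := resolvent_unit M (simplex_substochastic dpi').
have vE p : prod_simplex R n.+1 m.+1 p -> state_values M p = average p (Qvalue M p).
  by move=> dp; apply/colP => s; rewrite [LHS]mxE valueE.
suff : resolvent_inv M pi' *m (state_values M pi' - state_values M pi) =
    advantage M pi' pi by move=> <-; rewrite mulKmx.
have QE p : prod_simplex R n.+1 m.+1 p -> Qvalue M p = lookahead M (state_values M p).
  by move=> dp; rewrite vE//; apply/bellmanE; exact: Qvalue_bellman.
have v'E : state_values M pi' =
    policy_cost M pi' + (discount M *: state_trans M pi') *m state_values M pi'.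
  by rewrite {1}vE// QE// average_lookahead.
have avE : average pi' (Qvalue M pi) =
    policy_cost M pi' + (discount M *: state_trans M pi') *m state_values M pi.
  by rewrite QE// average_lookahead.
have -> : advantage M pi' pi = average pi' (Qvalue M pi) - state_values M pi.
  rewrite vE//; apply/colP => s; rewrite !mxE -sumrB.
  by apply: eq_bigr => a _; rewrite mulrBr ![Qvalue _ _ _ _ * _]mulrC.
rewrite avE /resolvent_inv mulmxBl mul1mx mulmxBr {1}v'E.
by apply/colP => s; rewrite !mxE; ring.
Qed.

(** A column G of the resolvent solves G = e + N G with e >= 0 and N >= 0, so it is
    nonnegative by the maximum principle, and then at least e. *)
Lemma invmx_resolvent_ge M pi s s' : prod_simplex R n.+1 m.+1 pi ->
  (s == s')%:R <= invmx (resolvent_inv M pi) s s'.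
Proof.
move=> dpi; have spi := simplex_substochastic dpi; have U := resolvent_unit M spi.
set N := discount M *: state_trans M pi.
have N0 i j : 0 <= N i j.
  rewrite !mxE mulr_ge0 ?discount_ge0//; apply: sumr_ge0 => a _.
  by rewrite mulr_ge0 ?trans_ge0// simplex_ge0.
have Nth i : \sum_j N i j <= discount M.
  by apply: le_trans (state_trans_row M i spi); apply: ler_sum => j _; exact: ler_norm.
set G := invmx _.
have GE i : G i s' = (i == s')%:R + \sum_j N i j * G j s'.
  have : resolvent_inv M pi *m G = 1%:M by rewrite mulmxV.
  rewrite /resolvent_inv mulmxBl mul1mx => /eqP; rewrite subr_eq => /eqP GE.
  by rewrite {1}GE !mxE.
have G0 i : 0 <= G i s'.
  apply: (superharmonic_ge0 (v := fun l => G l s') N0 Nth (discount_lt1 M)) => {}i.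
  by rewrite [leRHS]GE lerDr ler0n.
by rewrite GE lerDl; apply: sumr_ge0 => j _; rewrite mulr_ge0.
Qed.

Lemma J_dirac M pi s : J M (fun s' => (s' == s)%:R) pi = value M pi s.
Proof.
rewrite /J (bigD1 s)//= eqxx mul1r big1 ?addr0// => i /negbTE ->.
by rewrite mul0r.
Qed.

(** The occupation weights of the initial distribution alone give an equality but
    may vanish. Adding those of the counting measure on the states makes all weights
    positive, and costs only the sum over all states of the value differences, which
    is nonpositive by optimality from every state. *)
Lemma global_optimal_quasar M pistar : global_optimal M pistar ->
  generalized_quasar_convex (J M (init M)) (Qvalue M) pistar.
Proof.
move=> [ds opt]; have [rho0 rho1] := init_distr M.
split=> //; first by apply: opt; exact: init_distr.
pose G := invmx (resolvent_inv M pistar).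
have G0 s i : 0 <= G s i by apply: le_trans (invmx_resolvent_ge M s i ds); rewrite ler0n.
(* the summand 1 is the counting measure on the starting states *)
pose w i := \sum_s (init M s + 1) * G s i.
have w_gt0 i : 0 < w i.
  rewrite /w (bigD1 i)//= ltr_pwDl//.
    rewrite mulr_gt0//; first by rewrite ltr_wpDl.
    by apply: lt_le_trans (invmx_resolvent_ge M i i ds); rewrite eqxx.
  by apply: sumr_ge0 => s _; rewrite mulr_ge0// addr_ge0.
exists (fun i => (w i)^-1); split=> [i|pi dpi]; first by rewrite invr_gt0.
have optv s : value M pistar s <= value M pi s.
  rewrite -!J_dirac; apply: opt => //; split=> [s'|]; first exact: ler0n.
  by rewrite (bigD1 s)//= eqxx big1 ?addr0// => i /negbTE ->.
have dE s : value M pistar s - value M pi s = \sum_i G s i * advantage M pistar pi i 0.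
  have /colP/(_ s) := performance_difference M ds dpi.
  by rewrite !mxE.
have -> : \sum_i (w i)^-1^-1 * \sum_j Qvalue M pi i j * (pistar i j - pi i j) =
    \sum_s (init M s + 1) * (value M pistar s - value M pi s).
  under [RHS]eq_bigr do rewrite dE mulr_sumr.
  rewrite exchange_big; apply: eq_bigr => i _; rewrite invrK mulr_suml.
  by apply: eq_bigr => s _; rewrite mxE mulrA.
rewrite /J -big_split; apply: ler_sum => s _ /=.
by have := optv s; lra.
Qed.

End quasar.

Theorem proposition3p6 (R : realType) (n m : nat) (M : mdp R n m)
    (pistar : 'M[R]_(n.+1, m.+1)) (hopt : global_optimal M pistar) :
  generalized_quasar_convex (J M (init M)) (Qvalue M) pistar /\
  (let theta := discount M in
   let Theta1 := theta in let Theta2 := 1 : R in let K0 := 1%N in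
   exists y : 'M[R]_(n.+1, m.+1), bellman_defined M y /\
     (forall (K : nat) (pi : 'M[R]_(n.+1, m.+1)), (K0 < K)%N ->
        prod_simplex R n.+1 m.+1 pi ->
        `| taylor_rem_mx K (Qext M) y pi | <= Theta1 * theta ^+ K) /\
     (forall (K : nat) (pi : 'M[R]_(n.+1, m.+1)), (0 < K)%N ->
        prod_simplex R n.+1 m.+1 pi ->
        `| taylor_abs_mx K (Qext M) y pi | <= Theta2)).
Proof.
split; first exact: global_optimal_quasar.
have normE (A : 'M[R]_(n.+1, m.+1)) (e : R) : 0 <= e ->
    (forall i j, `|A i j| <= e) -> `|A| <= e.
  move=> e0 Ae; rewrite [leLHS]/Num.Def.normr/= mx_normrE (bigmax_le _ e0)//=.
have QextE pi : prod_simplex R n.+1 m.+1 pi -> Qext M pi = Qvalue M pi.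
  by rewrite /Qext; case: (pselect _).
exists 0; split; first exact: bellman_defined0.
split=> K pi _ dpi; have bq := Qvalue_bellman M dpi; apply: normE => //.
- by rewrite mulr_ge0 ?exprn_ge0 ?discount_ge0.
- move=> i j; rewrite mxE (taylor_rem_Qext K M (i, j)) QextE// -exprS.
  have /andP[e0 e1] := truncated_value_err K.+1 (i, j) dpi bq.
  by rewrite ger0_norm.
- move=> i j; rewrite mxE (taylor_abs_Qext K M (i, j) dpi).
  have /andP[e0 _] := truncated_value_err K.+1 (i, j) dpi bq.
  rewrite ger0_norm ?truncated_value_ge0//.
  have /andP[_] := bellman_itv01 dpi bq (i, j).
  by apply: le_trans; rewrite -subr_ge0.
Qed.
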